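(* Let $m\ge1$, $0<q<1$, $r,s\ge0$, $0\le n\le m$, and $d_{m;r,s}^n=\dim\mathcal M_{q;r,s}^n$. These dimensions are independent of $q\in(0,1)$. For $1\le n\le m-1$, $$d_{m;r,s}^n=\frac{(r+m-1)!\,(s+m-1)!\,(r+s+m)}{r!\,s!\,(m-1)!\,(n-1)!\,(m-n-1)!\,(r+n)(s+m-n)}.$$ At the spin endpoints, $$d_{m;r,s}^0=\delta_{r0}\binom{s+m-1}{m-1},\qquad d_{m;r,s}^m=\delta_{s0}\binom{r+m-1}{m-1}.$$
   Context: $\mathscr P_{r,s}^n$ is the space of polynomials in commuting variables $z_1,\dots,z_m,w_1,\dots,w_m$ of degree $r$ in $z$ and $s$ in $w$ with values in $\bigwedge^n\mathbb C^m$. $D_{q,x}f=\frac{f(\dots,qx,\dots)-f(\dots,x,\dots)}{(q-1)x}$ is the Jackson derivative; $\varepsilon_i$ is exterior multiplication by the $i$-th basis vector on $\bigwedge\mathbb C^m$, $\iota_i=\varepsilon_i^*$ contraction. $\mathcal D_q=\sum_i\varepsilon_iD_{q,z_i}$, $\mathcal D_q^\dagger=\sum_i\iota_iD_{q,w_i}$, and $\mathcal M_{q;r,s}^n=\ker\mathcal D_q\cap\ker\mathcal D_q^\dagger\cap\mathscr P_{r,s}^n$. *)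

(* Defs.v *)
From HB Require Import structures.
From mathcomp Require Import all_boot all_order all_algebra.
From mathcomp Require Import reals complex ssrcomplements mpoly.

Set Implicit Arguments.
Unset Strict Implicit.
Unset Printing Implicit Defensive.

Import GRing.Theory Num.Theory.
Local Open Scope ring_scope.

Section Jackson.
Context (n : nat) (F : fieldType).
Implicit Types (q : F) (k : 'I_n) (p : {mpoly F[n]}) (u : 'X_{1..n}).

Definition dilate q k p : {mpoly F[n]} :=
  p \mPo [tuple (if j == k then q *: 'X_j else 'X_j) | j < n].

(* The linear map with X^u |-> X^u / X_k. It is only meant for multiples of
   X_k: the exponent subtraction is truncated. *)
Definition divXk k p : {mpoly F[n]} :=
  \sum_(u <- msupp p) p@_u *: 'X_[(u - U_(k))%MM].

Definition jackson q k p : {mpoly F[n]} :=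
  (q - 1)^-1 *: divXk k (dilate q k p - p).

Lemma dilateX q k u : dilate q k 'X_[u] = q ^+ u k *: 'X_[u].
Proof.
rewrite /dilate comp_mpolyX (bigD1 k) //= tnth_mktuple eqxx exprZn -scalerAl.
congr (_ *: _); rewrite [RHS]mpolyXE_id [RHS](bigD1 k) //=; congr (_ * _).
by apply: eq_bigr => i /negbTE ik; rewrite tnth_mktuple ik.
Qed.

Lemma divXk_is_linear k : linear (divXk k).
Proof.
have divXkE j p : (msize p <= j)%N ->
    divXk k p = \sum_(u : 'X_{1..n < j}) p@_u *: 'X_[(u - U_(k))%MM].
  pose I : subFinType _ := 'X_{1..n < j}.
  move=> le_pj; rewrite /divXk (big_mksub I) /=; first last.
  - by move=> x /msize_mdeg_lt/leq_trans/(_ le_pj).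
  - by rewrite msupp_uniq.
  by rewrite big_rmcond //= => i /memN_msupp_eq0 ->; rewrite scale0r.
move=> c p p'; pose j := (msize p + msize p' + msize (c *: p + p'))%N.
rewrite !(divXkE j) /j ?leq_addl // -?addnA ?leq_addr //; last first.
  by rewrite addnCA leq_addr.
rewrite scaler_sumr -big_split /=; apply: eq_bigr => u _.
by rewrite scalerA -scalerDl mcoeffD mcoeffZ.
Qed.

HB.instance Definition _ k := GRing.isLinear.Build F {mpoly F[n]} {mpoly F[n]}
  _ (divXk k) (divXk_is_linear k).

Lemma jackson_is_linear q k : linear (jackson q k).
Proof.
move=> c p p'; rewrite /jackson /dilate linearP opprD addrACA -scalerBr.
by rewrite linearP scalerDr !scalerA mulrC.
Qed.

HB.instance Definition _ q k := GRing.isLinear.Build F {mpoly F[n]} {mpoly F[n]}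
  _ (jackson q k) (jackson_is_linear q k).

Lemma divXkX k u : divXk k 'X_[u] = 'X_[(u - U_(k))%MM].
Proof. by rewrite /divXk msuppX big_seq1 mcoeffX eqxx scale1r. Qed.

Lemma jacksonX q k u :
  jackson q k 'X_[u] = ((q ^+ u k - 1) / (q - 1)) *: 'X_[(u - U_(k))%MM].
Proof.
rewrite /jackson; have -> : dilate q k 'X_[u] - 'X_[u] = (q ^+ u k - 1) *: 'X_[u].
  by rewrite dilateX scalerBl scale1r.
by rewrite linearZ /= divXkX scalerA mulrC.
Qed.

(* The defining quotient of the Jackson derivative, with denominator cleared. *)
Lemma jacksonE q k p : q != 1 ->
  (q - 1) *: ('X_k * jackson q k p) = dilate q k p - p.
Proof.
move=> q1; elim/mpolyind: p => [|c u p _ _ IHp].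
  by rewrite linear0 mulr0 scaler0 /dilate linear0 subr0.
have dP : dilate q k (c *: 'X_[u] + p) = c *: dilate q k 'X_[u] + dilate q k p.
  by rewrite /dilate linearP.
rewrite linearP mulrDr scalerDr IHp dP opprD addrACA; congr (_ + _).
rewrite /= dilateX jacksonX -scalerBr -!scalerAr !scalerA.
rewrite -{2}['X_[u]]scale1r -scalerBl scalerA.
have [uk0|uk0] := eqVneq (u k) 0%N.
  by rewrite uk0 expr0 subrr mul0r !(mulr0, scale0r).
rewrite -mpolyXD addmC submK; last first.
  by apply/mnm_lepP => i; rewrite mnm1E; case: eqP => // <-; rewrite lt0n.
by congr (_ *: _); rewrite mulrCA [(q - 1) * _]mulrC divfK // subr_eq0.
Qed.

End Jackson.

Section Bidegree.
Context (m : nat).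

(* Among m + m variables, lshift m i is z_i and rshift m i is w_i. *)
Definition zdeg (u : 'X_{1..m + m}) : nat := (\sum_(i < m) u (lshift m i))%N.
Definition wdeg (u : 'X_{1..m + m}) : nat := (\sum_(i < m) u (rshift m i))%N.

Lemma zdeg0 : zdeg 0%MM = 0%N.
Proof. by rewrite /zdeg big1 // => i _; rewrite mnm0E. Qed.
Lemma zdegD : {morph zdeg : u v / (u + v)%MM >-> (u + v)%N}.
Proof. by move=> u v; rewrite -big_split; apply: eq_bigr => i; rewrite mnmDE. Qed.
HB.instance Definition _ := isMeasure.Build (m + m) zdeg zdeg0 zdegD.

Lemma wdeg0 : wdeg 0%MM = 0%N.
Proof. by rewrite /wdeg big1 // => i _; rewrite mnm0E. Qed.
Lemma wdegD : {morph wdeg : u v / (u + v)%MM >-> (u + v)%N}.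
Proof. by move=> u v; rewrite -big_split; apply: eq_bigr => i; rewrite mnmDE. Qed.
HB.instance Definition _ := isMeasure.Build (m + m) wdeg wdeg0 wdegD.

Lemma mdeg_zw u : mdeg u = (zdeg u + wdeg u)%N.
Proof. by rewrite mdegE big_split_ord. Qed.

Lemma zdeg_z i : zdeg U_(lshift m i) = 1%N.
Proof.
rewrite /zdeg (bigD1 i) //= mnm1E eqxx big1 // => j /negbTE ji.
by rewrite mnm1E (inj_eq (@lshift_inj _ _)) eq_sym ji.
Qed.
Lemma wdeg_z i : wdeg U_(lshift m i) = 0%N.
Proof. by rewrite /wdeg big1 // => j _; rewrite mnm1E eq_lrshift. Qed.
Lemma zdeg_w i : zdeg U_(rshift m i) = 0%N.
Proof. by rewrite /zdeg big1 // => j _; rewrite mnm1E eq_rlshift. Qed.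
Lemma wdeg_w i : wdeg U_(rshift m i) = 1%N.
Proof.
rewrite /wdeg (bigD1 i) //= mnm1E eqxx big1 // => j /negbTE ji.
by rewrite mnm1E (inj_eq (@rshift_inj _ _)) eq_sym ji.
Qed.

Definition is_bihomog (F : fieldType) (r s : nat) (p : {mpoly F[m + m]}) :=
  (p \is r.-homog for zdeg) && (p \is s.-homog for wdeg).

Lemma jackson_bihomog (F : fieldType) (q : F) k r s (p : {mpoly F[m + m]}) :
    is_bihomog r s p ->
  is_bihomog (r - zdeg U_(k)) (s - wdeg U_(k)) (jackson q k p).
Proof.
case/andP => /dhomogP hz /dhomogP hw; rewrite [p in jackson _ _ p]mpolyE.
suff H u : u \in msupp p ->
    is_bihomog (r - zdeg U_(k)) (s - wdeg U_(k)) (jackson q k 'X_[u]).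
  rewrite linear_sum; apply/andP; split; rewrite big_seq; apply: rpred_sum => u;
  by move=> /H/andP[? ?]; rewrite linearZ rpredZ.
move=> up; rewrite jacksonX.
have [uk0|uk0] := eqVneq (u k) 0%N.
  by rewrite uk0 expr0 subrr mul0r scale0r /is_bihomog !rpred0.
have e : u = (u - U_(k) + U_(k))%MM.
  rewrite submK //; apply/mnm_lepP => i; rewrite mnm1E.
  by case: eqP => // <-; rewrite lt0n.
apply/andP; split; rewrite rpredZ // dhomogX /=.
  by rewrite -(hz _ up) /= {2}e zdegD addnK.
by rewrite -(hw _ up) /= {2}e wdegD addnK.
Qed.

End Bidegree.

Section Exterior.
Context (m : nat) (C : numClosedFieldType).

(* \bigwedge C^m has the orthonormal basis e_I = e_i1 /\ ... /\ e_ik, over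
   I = {i1 < ... < ik}. An element of (C[z,w]) (x) \bigwedge C^m is given by its
   family of coordinates. *)
Definition extpoly := {ffun {set 'I_m} -> {mpoly C[m + m]}}.

(* Coordinate on e_J of e_i /\ e_I. *)
Definition eps_coef (i : 'I_m) (J I : {set 'I_m}) : C :=
  if (i \notin I) && (J == i |: I)
  then (-1) ^+ #|[set j in I | (j < i)%N]| else 0.

(* Adjoint matrix. *)
Definition iota_coef (i : 'I_m) (J I : {set 'I_m}) : C := (eps_coef i I J)^*.

Definition ext_eps (i : 'I_m) (f : extpoly) : extpoly :=
  [ffun J => \sum_I eps_coef i J I *: f I].

Definition ext_iota (i : 'I_m) (f : extpoly) : extpoly :=
  [ffun J => \sum_I iota_coef i J I *: f I].

Definition ext_jackson (q : C) (k : 'I_(m + m)) (f : extpoly) : extpoly :=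
  [ffun I => jackson q k (f I)].

Definition Dq (q : C) (f : extpoly) : extpoly :=
  \sum_(i < m) ext_eps i (ext_jackson q (lshift m i) f).

Definition Dq_dag (q : C) (f : extpoly) : extpoly :=
  \sum_(i < m) ext_iota i (ext_jackson q (rshift m i) f).

Lemma ext_eps_is_linear i : linear (ext_eps i).
Proof.
move=> c f g; apply/ffunP => J; rewrite !ffunE scaler_sumr -big_split /=.
by apply: eq_bigr => I _; rewrite !ffunE scalerDr !scalerA [c * _]mulrC.
Qed.
Lemma ext_iota_is_linear i : linear (ext_iota i).
Proof.
move=> c f g; apply/ffunP => J; rewrite !ffunE scaler_sumr -big_split /=.
by apply: eq_bigr => I _; rewrite !ffunE scalerDr !scalerA [c * _]mulrC.
Qed.
Lemma ext_jackson_is_linear q k : linear (ext_jackson q k).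
Proof. by move=> c f g; apply/ffunP => J; rewrite !ffunE linearP. Qed.

Lemma Dq_is_linear q : linear (Dq q).
Proof.
move=> c f g; rewrite scaler_sumr -big_split; apply: eq_bigr => i _ /=.
by rewrite ext_jackson_is_linear ext_eps_is_linear.
Qed.
Lemma Dq_dag_is_linear q : linear (Dq_dag q).
Proof.
move=> c f g; rewrite scaler_sumr -big_split; apply: eq_bigr => i _ /=.
by rewrite ext_jackson_is_linear ext_iota_is_linear.
Qed.

Definition is_bihomform (r s n : nat) : pred extpoly := fun f =>
  [forall I, is_bihomog r s (f I) && ((#|I| != n) ==> (f I == 0))].

Lemma is_bihomformP r s n (f : extpoly) :
  reflect (forall I, is_bihomog r s (f I) /\ (#|I| <> n -> f I = 0))
          (is_bihomform r s n f).
Proof.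
apply: (iffP forallP) => H I.
  have /andP[h /implyP k] := H I; split => // /eqP nI.
  exact/eqP/k.
by have [-> k] := H I; apply/implyP => /eqP/k ->.
Qed.

Lemma is_bihomform_submod r s n : submod_closed (is_bihomform r s n).
Proof.
split=> [|c f g /is_bihomformP hf /is_bihomformP hg]; apply/is_bihomformP => I.
  by rewrite ffunE /is_bihomog !rpred0.
have [/andP[? ?] fI] := hf I; have [/andP[? ?] gI] := hg I.
rewrite !ffunE /is_bihomog !(rpredD, rpredZ) //; split => // nI.
by rewrite fI // gI // scaler0 addr0.
Qed.

HB.instance Definition _ r s n :=
  GRing.isSubmodClosed.Build C extpoly (is_bihomform r s n)
    (is_bihomform_submod r s n).

Lemma eps_coef_neq0 i J I : eps_coef i J I != 0 -> #|J| = #|I|.+1.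
Proof.
rewrite /eps_coef; case: ifP => [/andP[iI /eqP->] _|]; last by rewrite eqxx.
by rewrite cardsU1 iI.
Qed.

Lemma Dq_bihom q r s n (f : extpoly) :
  is_bihomform r s n f -> is_bihomform r.-1 s n.+1 (Dq q f).
Proof.
move=> /is_bihomformP hf; apply: rpred_sum => i _; apply/is_bihomformP => J.
rewrite ffunE; split=> [|nJ].
  apply/andP; split; apply: rpred_sum => I _; apply: rpredZ; rewrite ffunE;
  have /(jackson_bihomog q (lshift m i))/andP[] := (hf I).1;
  by rewrite zdeg_z wdeg_z subn1 subn0.
apply: big1 => I _; rewrite ffunE.
have [->|/eps_coef_neq0 JI] := eqVneq (eps_coef i J I) 0; first exact: scale0r.
by rewrite (hf I).2 ?linear0 ?scaler0 // => nI; rewrite JI nI in nJ.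
Qed.

Lemma Dq_dag_bihom q r s n (f : extpoly) :
  is_bihomform r s n f -> is_bihomform r s.-1 n.-1 (Dq_dag q f).
Proof.
move=> /is_bihomformP hf; apply: rpred_sum => i _; apply/is_bihomformP => J.
rewrite ffunE; split=> [|nJ].
  apply/andP; split; apply: rpred_sum => I _; apply: rpredZ; rewrite ffunE;
  have /(jackson_bihomog q (rshift m i))/andP[] := (hf I).1;
  by rewrite zdeg_w wdeg_w subn1 subn0.
apply: big1 => I _; rewrite ffunE /iota_coef.
have [->|/eps_coef_neq0 JI] := eqVneq (eps_coef i I J) 0.
  by rewrite conjC0 scale0r.
by rewrite (hf I).2 ?linear0 ?scaler0 // => nI; rewrite -nI JI in nJ.
Qed.

End Exterior.

Section Monogenic.
Context (m : nat) (C : numClosedFieldType).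

(* The space P_{r,s}^n. *)
Record bihomform (r s n : nat) := Bihomform {
  bihomform_val :> extpoly m C;
  bihomformP : is_bihomform r s n bihomform_val }.

Section Structure.
Context (r s n : nat).

HB.instance Definition _ := [isSub for @bihomform_val r s n].
HB.instance Definition _ := [Choice of bihomform r s n by <:].
HB.instance Definition _ := [SubChoice_isSubLmodule of bihomform r s n by <:].

Definition bihom_idx := {x : {set 'I_m} * bmultinom (m + m) (r + s).+1 |
  [&& #|x.1| == n, zdeg x.2 == r & wdeg x.2 == s]}.

Lemma bihomform_vecaxiom :
  Vector.axiom #|{: bihom_idx}| (bihomform r s n).
Proof.
pose f (p : bihomform r s n) : 'rV[C]_#|{: bihom_idx}| :=
  \row_k (let x : bihom_idx := enum_val k in
             (bihomform_val p (val x).1)@_(val x).2).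
exists f => [c p p'|].
  have valP' I : bihomform_val (c *: p + p') I =
      c *: bihomform_val p I + bihomform_val p' I.
    by rewrite [LHS]ffunE [X in X + _]ffunE.
  by apply/rowP => k; rewrite !mxE /= -mcoeffZ -mcoeffD -valP'.
pose g (v : 'rV[C]_#|{: bihom_idx}|) : extpoly m C :=
  [ffun I => \sum_(x : bihom_idx | (val x).1 == I)
     v 0 (enum_rank x) *: 'X_[(val x).2]].
have gP v : is_bihomform r s n (g v).
  apply/is_bihomformP => I; rewrite ffunE; split=> [|nI].
    apply/andP; split; apply: rpred_sum => x _; rewrite rpredZ // dhomogX;
    by have /and3P[] := valP x.
  by apply: big1 => x /eqP xI; have /and3P[/eqP] := valP x; rewrite xI.
have gE v (x : bihom_idx) :
    (g v (val x).1)@_(val x).2 = v 0 (enum_rank x).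
  rewrite ffunE raddf_sum (bigD1 x) //= mcoeffZ mcoeffX eqxx mulr1 big1 ?addr0 //.
  move=> y /andP[/eqP y1 yx]; rewrite mcoeffZ mcoeffX; case: eqP => [e|];
    last by rewrite mulr0.
  by case/eqP: yx; apply/val_inj/eqP; rewrite -pair_eqE /= /pair_eq y1 bmeqP e !eqxx.
exists (fun v => Bihomform (gP v)) => [p|v]; last first.
  by apply/rowP => k; rewrite mxE; apply: etrans (gE _ _) _; rewrite enum_valK.
apply/val_inj/ffunP => I; apply/mpolyP => u /=.
have /is_bihomformP/(_ I)[/andP[hz hw] pI] := bihomformP p.
case: (boolP [&& #|I| == n, zdeg u == r & wdeg u == s]) => [h|].
  have ub : (mdeg u < (r + s).+1)%N.
    by case/and3P: h => _ /eqP <- /eqP <-; rewrite mdeg_zw.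
  pose x : bihom_idx := exist _ (I, BMultinom ub) h.
  have /= -> := gE (f p) x.
  by rewrite mxE enum_rankK.
move=> nh; have -> : (bihomform_val p I)@_u = 0.
  move: nh; rewrite !negb_and => /or3P[/eqP/pI->|nz|nw].
  - exact: mcoeff0.
  - exact: dhomog_nemf_coeff hz nz.
  - exact: dhomog_nemf_coeff hw nw.
rewrite ffunE raddf_sum big1 // => x /eqP xI.
rewrite /= mcoeffZ mcoeffX; case: eqP => [e|]; last by rewrite mulr0.
by have := valP x; rewrite xI e (negbTE nh).
Qed.

HB.instance Definition _ :=
  Lmodule_hasFinDim.Build C (bihomform r s n) bihomform_vecaxiom.

End Structure.

(* Dq vanishes on P_{0,s}^n and Dq_dag vanishes on P_{r,0}^n and P_{r,s}^0, so
   the truncated predecessors below do no harm. *)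
Definition Dq_rs (q : C) (r s n : nat) (f : bihomform r s n) :
    bihomform r.-1 s n.+1 :=
  Bihomform (Dq_bihom q (bihomformP f)).

Definition Dq_dag_rs (q : C) (r s n : nat) (f : bihomform r s n) :
    bihomform r s.-1 n.-1 :=
  Bihomform (Dq_dag_bihom q (bihomformP f)).

Lemma Dq_rs_is_linear q r s n : linear (@Dq_rs q r s n).
Proof. by move=> c f g; apply/val_inj; rewrite /= Dq_is_linear. Qed.
HB.instance Definition _ q r s n :=
  GRing.isLinear.Build C (bihomform r s n) (bihomform r.-1 s n.+1) _
    (@Dq_rs q r s n) (@Dq_rs_is_linear q r s n).

Lemma Dq_dag_rs_is_linear q r s n : linear (@Dq_dag_rs q r s n).
Proof. by move=> c f g; apply/val_inj; rewrite /= Dq_dag_is_linear. Qed.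
HB.instance Definition _ q r s n :=
  GRing.isLinear.Build C (bihomform r s n) (bihomform r s.-1 n.-1) _
    (@Dq_dag_rs q r s n) (@Dq_dag_rs_is_linear q r s n).

Definition monogenic (q : C) (r s n : nat) : {vspace bihomform r s n} :=
  (lker (linfun (@Dq_rs q r s n)) :&: lker (linfun (@Dq_dag_rs q r s n)))%VS.

Lemma memv_monogenic q r s n (f : bihomform r s n) :
  (f \in monogenic q r s n) = (Dq q f == 0) && (Dq_dag q f == 0).
Proof. by rewrite memv_cap !memv_ker !lfunE. Qed.

End Monogenic.

Definition dim_monogenic (R : realType) (m : nat) (q : R) (r s n : nat) : nat :=
  \dim (monogenic m (q%:C%C : R[i]) r s n).

(* Main.v *)
Require Import Defs.
From HB Require Import structures.
From mathcomp Require Import all_boot all_order all_algebra.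
From mathcomp Require Import reals complex ssrcomplements mpoly.
From mathcomp Require Import ring lra zify.

(* Rescaling the multiplication operators to Z_k X^u = (u_k + 1)/[u_k + 1]_q X^(u + e_k)
   turns the Jackson derivatives D_k into an undeformed Weyl algebra: D_j Z_k - Z_k D_j
   is 1 or 0 according to whether j = k. Put
     d = Dq, e = Dq_dag, x = Xq = sum_i iota_i Z_(z_i), y = Xq_dag = sum_i eps_i Z_(w_i).
   Then d^2 = e^2 = {d, y} = {e, x} = 0, and on P_(r,s)^n the anticommutators {d, x} and
   {e, y} are the scalars r + n and s + m - n. With lap = {d, e} and rho = {x, y} one gets
   [lap, rho] = r + s + m. From these relations alone follow explicit preimages showing
   that the three maps
     lap : P_(r+1,s+1)^n -> P_(r,s)^n,
     d   : ker lap in P_(r+1,s)^n -> ker d and ker lap in P_(r,s)^(n+1)   (r + n > 0),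
     e   : ker d and ker lap in P_(r,s+1)^(n+1) -> M_(r,s)^n              (n < s + m)
   are onto. Rank-nullity then determines dim M recursively from the dimensions of the
   P_(r,s)^n, which do not involve q, and the closed formula satisfies this recursion. *)

Set Implicit Arguments.
Unset Strict Implicit.
Unset Printing Implicit Defensive.

Import Order.TTheory GRing.Theory Num.Theory.
Local Open Scope ring_scope.

(** * A Weyl algebra containing the Jackson derivatives *)

Section MonomialExtension.
Context (n : nat) (F : fieldType) (g : 'X_{1..n} -> {mpoly F[n]}).
Implicit Types (p : {mpoly F[n]}) (u : 'X_{1..n}).

Definition mlin p : {mpoly F[n]} := \sum_(u <- msupp p) p@_u *: g u.

Lemma mlin_is_linear : linear mlin.
Proof.
have mlinE j p : (msize p <= j)%N ->
    mlin p = \sum_(u : 'X_{1..n < j}) p@_u *: g u.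
  pose I : subFinType _ := 'X_{1..n < j}.
  move=> le_pj; rewrite /mlin (big_mksub I) /=; first last.
  - by move=> x /msize_mdeg_lt/leq_trans/(_ le_pj).
  - by rewrite msupp_uniq.
  by rewrite big_rmcond //= => i /memN_msupp_eq0 ->; rewrite scale0r.
move=> c p p'; pose j := (msize p + msize p' + msize (c *: p + p'))%N.
rewrite !(mlinE j) /j ?leq_addl // -?addnA ?leq_addr //; last first.
  by rewrite addnCA leq_addr.
rewrite scaler_sumr -big_split /=; apply: eq_bigr => u _.
by rewrite scalerA -scalerDl mcoeffD mcoeffZ.
Qed.

HB.instance Definition _ :=
  GRing.isLinear.Build F {mpoly F[n]} {mpoly F[n]} _ mlin mlin_is_linear.

Lemma mlinX u : mlin 'X_[u] = g u.
Proof. by rewrite /mlin msuppX big_seq1 mcoeffX eqxx scale1r. Qed.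

End MonomialExtension.

(** Taking bare functions with proofs of linearity, not bundled maps, lets this apply directly to
    composites of operators. *)
Lemma eq_linear_mpoly (n : nat) (F : fieldType) (S T : {mpoly F[n]} -> {mpoly F[n]}) :
  linear S -> linear T -> (forall u, S 'X_[u] = T 'X_[u]) -> S =1 T.
Proof.
move=> linS linT ST.
pose iS := GRing.isLinear.Build _ _ _ _ S linS.
pose iT := GRing.isLinear.Build _ _ _ _ T linT.
pose lS : {linear {mpoly F[n]} -> {mpoly F[n]}} := HB.pack S iS.
pose lT : {linear {mpoly F[n]} -> {mpoly F[n]}} := HB.pack T iT.
move=> p; rewrite -[S p]/(lS p) -[T p]/(lT p) [p]mpolyE !linear_sum.
by apply: eq_bigr => u _; rewrite !linearZ; congr (_ *: _); apply: ST.
Qed.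

Section Weyl.
Context (n : nat) (F : fieldType) (q : F).
(** Makes every quantum integer [k+1]_q = (q^(k+1) - 1)/(q - 1) invertible; the exponent 1 gives q
    != 1. *)
Hypothesis q_torsionfree : forall k, q ^+ k.+1 != 1.
Implicit Types (i j k : 'I_n) (p : {mpoly F[n]}) (u : 'X_{1..n}).

(* The scalar turns the Jackson derivatives and the raising operators into a
   representation of the undeformed Weyl algebra. *)
Definition raise k : {mpoly F[n]} -> {mpoly F[n]} :=
  mlin (fun u => ((u k).+1%:R * (q - 1) / (q ^+ (u k).+1 - 1))
                   *: 'X_[(u + U_(k))%MM]).

HB.instance Definition _ k := GRing.Linear.on (raise k).

Lemma q_neq1 : q - 1 != 0.
Proof. by rewrite subr_eq0 -[q]expr1 q_torsionfree. Qed.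

Lemma jackson0X k u : u k = 0%N -> jackson q k 'X_[u] = 0.
Proof. by move=> uk; rewrite jacksonX uk expr0 subrr mul0r scale0r. Qed.

Lemma raiseX k u : raise k 'X_[u] =
  ((u k).+1%:R * (q - 1) / (q ^+ (u k).+1 - 1)) *: 'X_[(u + U_(k))%MM].
Proof. exact: mlinX. Qed.

(** The quantum integer produced by [jackson] cancels the denominator in [raise], leaving an
    ordinary integer. In the opposite order the same cancellation leaves u_k. *)
Lemma jackson_raiseX k u : jackson q k (raise k 'X_[u]) = (u k).+1%:R *: 'X_[u].
Proof.
rewrite raiseX linearZ /= jacksonX mnmDE mnm1E eqxx addn1 scalerA addmK.
congr (_ *: _); have := q_torsionfree (u k); rewrite -subr_eq0 => qu.
by rewrite mulrA divfK // mulfK // q_neq1.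
Qed.

Lemma raise_jacksonX k u : raise k (jackson q k 'X_[u]) = (u k)%:R *: 'X_[u].
Proof.
have [uk0|] := posnP (u k); first by rewrite jackson0X // uk0 linear0 scale0r.
move=> uk; have uE : (u = (u - U_(k)) + U_(k))%MM.
  by rewrite submK //; apply/mnm_lepP => i; rewrite mnm1E; case: eqP => // <-.
have vk : (u k).-1 = (u - U_(k))%MM k by rewrite mnmBE mnm1E eqxx subn1.
rewrite jacksonX linearZ /= raiseX -vk prednK // -uE scalerA.
congr (_ *: _); have := q_torsionfree (u k).-1; rewrite prednK // -subr_eq0 => qu.
by rewrite mulrC mulrA divfK // mulfK // q_neq1.
Qed.

Lemma jacksonC i j p : jackson q i (jackson q j p) = jackson q j (jackson q i p).
Proof.
have [->//|ij] := eqVneq i j.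
move: p; apply: eq_linear_mpoly => [c f g|c f g|u].
- by rewrite !linearP.
- by rewrite !linearP.
rewrite [in LHS]jacksonX [in RHS]jacksonX !linearZ /= !jacksonX !scalerA.
rewrite !mnmBE !mnm1E eq_sym (negbTE ij) !subn0 mulrC; congr (_ *: 'X_[_]).
by apply/mnmP => k; rewrite !mnmBE subnAC.
Qed.

Lemma jackson_raiseC i j p : i != j ->
  jackson q i (raise j p) = raise j (jackson q i p).
Proof.
move=> ij; move: p; apply: eq_linear_mpoly => [c f g|c f g|u].
- by rewrite !linearP.
- by rewrite !linearP.
rewrite raiseX [in RHS]jacksonX !linearZ /= raiseX jacksonX !scalerA.
rewrite mnmDE mnmBE !mnm1E [j == i]eq_sym (negbTE ij) !(subn0, addn0).
have [ui|ui] := posnP (u i).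
  by rewrite ui expr0 subrr !(mul0r, mulr0) !scale0r.
rewrite mulrC; congr (_ *: 'X_[_]).
apply/mnmP => k; rewrite !(mnmBE, mnmDE) !mnm1E addnBAC //.
by case: eqP => // <-.
Qed.

(** For i = j the two composites have eigenvalues u_i + 1 and u_i on X^u, whose difference is 1. *)
Lemma jackson_raise i j p :
  jackson q i (raise j p) = raise j (jackson q i p) + (i == j)%:R *: p.
Proof.
have [->|ij] := eqVneq i j; last by rewrite jackson_raiseC // scale0r addr0.
rewrite scale1r; move: p; apply: eq_linear_mpoly => [c f g|c f g|u].
- by rewrite !linearP.
- by rewrite !linearP /= scalerDr addrACA.
by rewrite jackson_raiseX raise_jacksonX -{3}['X_[u]]scale1r -scalerDl -natr1.
Qed.

End Weyl.

(** * Bidegrees and Euler operators *)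

Section Bidegree.
Context (m : nat) (F : fieldType) (q : F).
Hypothesis q_torsionfree : forall k, q ^+ k.+1 != 1.
Implicit Types (p : {mpoly F[m + m]}).

Lemma raise_bihomog k r s p : is_bihomog r s p ->
  is_bihomog (r + zdeg U_(k)) (s + wdeg U_(k)) (raise q k p).
Proof.
case/andP => /dhomogP hz /dhomogP hw; rewrite [p in raise _ _ p]mpolyE.
rewrite linear_sum; apply/andP; split; rewrite big_seq; apply: rpred_sum => u up;
  rewrite linearZ rpredZ //= raiseX rpredZ // dhomogX /=.
- by rewrite zdegD -(hz _ up).
- by rewrite wdegD -(hw _ up).
Qed.

Lemma bihomog_ind r s (P : {mpoly F[m + m]} -> Prop) :
  P 0 -> (forall c f g, P f -> P g -> P (c *: f + g)) ->
  (forall u, zdeg u = r -> wdeg u = s -> P 'X_[u]) ->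
  forall p, is_bihomog r s p -> P p.
Proof.
move=> P0 PD PX p /andP[/dhomogP hz /dhomogP hw]; rewrite [p]mpolyE.
rewrite big_seq; apply: (@big_ind _ P) => // [f g Pf Pg|u up].
  by rewrite -[f]scale1r; apply: PD.
by rewrite -[X in P X]addr0; apply: PD => //; apply: PX; [apply: hz|apply: hw].
Qed.

(** Each summand multiplies X^u by the exponent of z_i, so the eigenvalue is the ordinary degree r
    and not a quantum integer. *)
Lemma euler_z r s p : is_bihomog r s p ->
  \sum_(i < m) raise q (lshift m i) (jackson q (lshift m i) p) = r%:R *: p.
Proof.
move: p; apply: bihomog_ind => [|c f g IHf IHg|u <- _].
- by rewrite scaler0 big1 // => i _; rewrite !linear0.
- rewrite scalerDr scalerA mulrC -scalerA -IHf -IHg scaler_sumr -big_split.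
  by apply: eq_bigr => i _; rewrite !linearP.
- rewrite /zdeg natr_sum scaler_suml; apply: eq_bigr => i _.
  exact: raise_jacksonX.
Qed.

Lemma euler_w r s p : is_bihomog r s p ->
  \sum_(i < m) raise q (rshift m i) (jackson q (rshift m i) p) = s%:R *: p.
Proof.
move: p; apply: bihomog_ind => [|c f g IHf IHg|u _ <-].
- by rewrite scaler0 big1 // => i _; rewrite !linear0.
- rewrite scalerDr scalerA mulrC -scalerA -IHf -IHg scaler_sumr -big_split.
  by apply: eq_bigr => i _; rewrite !linearP.
- rewrite /wdeg natr_sum scaler_suml; apply: eq_bigr => i _.
  exact: raise_jacksonX.
Qed.

Lemma jackson_zdeg0 i s p : is_bihomog 0 s p -> jackson q (lshift m i) p = 0.
Proof.
move: p; apply: bihomog_ind => [|c f g IHf IHg|u /eqP u0 _].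
- exact: linear0.
- by rewrite linearP /= IHf IHg scaler0 addr0.
- by apply: jackson0X; move: u0; rewrite sum_nat_eq0 => /forallP/(_ i)/eqP.
Qed.

Lemma jackson_wdeg0 i r p : is_bihomog r 0 p -> jackson q (rshift m i) p = 0.
Proof.
move: p; apply: bihomog_ind => [|c f g IHf IHg|u _ /eqP u0].
- exact: linear0.
- by rewrite linearP /= IHf IHg scaler0 addr0.
- by apply: jackson0X; move: u0; rewrite sum_nat_eq0 => /forallP/(_ i)/eqP.
Qed.

End Bidegree.

(** * Creation and annihilation operators on the exterior algebra *)

Section Clifford.
Context (m : nat) (C : numClosedFieldType).
Implicit Types (i j : 'I_m) (I J : {set 'I_m}) (f : extpoly m C).

HB.instance Definition _ i := GRing.isLinear.Build C (extpoly m C) (extpoly m C) _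
  (ext_eps i) (@ext_eps_is_linear m C i).
HB.instance Definition _ i := GRing.isLinear.Build C (extpoly m C) (extpoly m C) _
  (ext_iota i) (@ext_iota_is_linear m C i).
HB.instance Definition _ q k := GRing.isLinear.Build C (extpoly m C) (extpoly m C) _
  (ext_jackson q k) (@ext_jackson_is_linear m C q k).
HB.instance Definition _ q := GRing.isLinear.Build C (extpoly m C) (extpoly m C) _
  (Dq q) (@Dq_is_linear m C q).
HB.instance Definition _ q := GRing.isLinear.Build C (extpoly m C) (extpoly m C) _
  (Dq_dag q) (@Dq_dag_is_linear m C q).

(** The Koszul sign of moving e_i past the elements of J that precede it. *)
Definition ext_sign i J : C := (-1) ^+ #|[set j in J | (j < i)%N]|.

Lemma ext_sign_sqr i J : ext_sign i J * ext_sign i J = 1.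
Proof. by rewrite /ext_sign -expr2 sqrr_sign. Qed.

Lemma ext_signU1 i j J : j \notin J ->
  ext_sign i (j |: J) = (-1) ^+ (j < i)%N * ext_sign i J.
Proof.
move=> jJ; rewrite /ext_sign -exprD; congr (_ ^+ _).
have [ji|ji] := boolP (j < i)%N.
  rewrite -[RHS](_ : #|j |: [set k in J | (k < i)%N]| = _).
    congr #|pred_of_set _|; apply/setP => k; rewrite !inE.
    by case: eqP => // ->.
  by rewrite cardsU1 !inE (negbTE jJ).
rewrite add0n; congr #|pred_of_set _|; apply/setP => k; rewrite !inE.
by case: eqP => // ->; rewrite (negbTE jJ) (negbTE ji).
Qed.

Lemma ext_signD1 i j J : j \in J ->
  ext_sign i J = (-1) ^+ (j < i)%N * ext_sign i (J :\ j).
Proof. by move=> jJ; rewrite -ext_signU1 ?setD1K // !inE eqxx. Qed.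

(** Only the term I = J :\ i of the matrix product survives; likewise only I = i |: J for the
    contraction. *)
Lemma ext_epsE i f J :
  ext_eps i f J = if i \in J then ext_sign i (J :\ i) *: f (J :\ i) else 0.
Proof.
rewrite ffunE; case: ifP => iJ; last first.
  apply: big1 => I _; rewrite /eps_coef; case: ifP; last by rewrite scale0r.
  by case/andP => _ /eqP eJ; rewrite eJ !inE eqxx in iJ.
rewrite (bigD1 (J :\ i)) //= big1 ?addr0 => [|I IJ]; rewrite /eps_coef.
  by rewrite setD1K // !inE !eqxx.
case: ifP; last by rewrite scale0r.
by case/andP => iI /eqP eJ; case/eqP: IJ; rewrite eJ setU1K.
Qed.

Lemma ext_iotaE i f J :
  ext_iota i f J = if i \in J then 0 else ext_sign i J *: f (i |: J).
Proof.
rewrite ffunE; case: ifP => iJ.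
  apply: big1 => I _; rewrite /iota_coef /eps_coef iJ /= conjC0.
  by rewrite scale0r.
rewrite (bigD1 (i |: J)) //= big1 ?addr0 => [|I IJ]; rewrite /iota_coef /eps_coef.
  by rewrite iJ eqxx /= rmorphXn /= rmorphN1.
by rewrite (negbTE IJ) andbF conjC0 scale0r.
Qed.

(** Exactly one of i < j and j < i holds; every anticommutation of distinct indices below rests on
    this. *)
Lemma sign_ltn_swap i j : i != j ->
  (-1) ^+ (i < j)%N = - (-1) ^+ (j < i)%N :> C.
Proof.
by move=> /eqP ij; have [lt|lt|/val_inj] // := ltngtP i j; rewrite opprK.
Qed.

Lemma ext_eps_anticomm i j f : ext_eps i (ext_eps j f) + ext_eps j (ext_eps i f) = 0.
Proof.
apply/ffunP => J; rewrite [LHS]ffunE [RHS]ffunE !ext_epsE !in_setD1 eq_sym.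
have [<-|ji] /= := eqVneq i j.
  by case: ifP; rewrite ?scaler0 addr0.
case iJ: (i \in J); case jJ: (j \in J); rewrite ?scaler0 ?addr0 //.
rewrite !scalerA (@ext_signD1 i j (J :\ i)) ?inE ?jJ 1?eq_sym ?ji //.
rewrite (@ext_signD1 j i (J :\ j)) ?inE ?iJ ?ji //.
have -> : J :\ j :\ i = J :\ i :\ j by rewrite !setDDl setUC.
rewrite -scalerDl (sign_ltn_swap ji).
by rewrite [X in X *: _](_ : _ = 0) ?scale0r //; ring.
Qed.

Lemma ext_iota_anticomm i j f :
  ext_iota i (ext_iota j f) + ext_iota j (ext_iota i f) = 0.
Proof.
apply/ffunP => J; rewrite [LHS]ffunE [RHS]ffunE !ext_iotaE !in_setU1 eq_sym.
have [<-|ji] /= := eqVneq i j.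
  by case: ifP; rewrite ?scaler0 addr0.
case iJ: (i \in J); case jJ: (j \in J); rewrite ?scaler0 ?addr0 //.
rewrite !scalerA !ext_signU1 ?iJ ?jJ // setUCA -scalerDl (sign_ltn_swap ji).
by rewrite [X in X *: _](_ : _ = 0) ?scale0r //; ring.
Qed.

(** For i = j exactly one of the two terms survives, with a squared sign. For i != j both vanish
    unless i is in J and j is not, and then they cancel. *)
Lemma ext_eps_iota i j f :
  ext_eps i (ext_iota j f) + ext_iota j (ext_eps i f) = (i == j)%:R *: f.
Proof.
apply/ffunP => J; rewrite [LHS]ffunE [RHS]ffunE !ext_iotaE !ext_epsE !ext_iotaE.
rewrite in_setU1 in_setD1 [j == i]eq_sym.
have [<-|ij] /= := eqVneq i j.
  rewrite scale1r; case: ifP => iJ; rewrite ?add0r ?addr0 scalerA.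
    by rewrite setD1K // ext_sign_sqr scale1r.
  by rewrite setU1K ?iJ // ext_sign_sqr scale1r.
rewrite scale0r; case iJ: (i \in J); case jJ: (j \in J); rewrite ?scaler0 ?addr0 //.
have -> : (j |: J) :\ i = j |: (J :\ i).
  by apply/setP => k; rewrite !inE; case: (eqVneq k i) => [->|] //; rewrite (negbTE ij).
rewrite !scalerA (@ext_signU1 i j) ?inE ?jJ ?andbF //.
rewrite (@ext_signD1 j i J) // -scalerDl (sign_ltn_swap ij) mulNr mulNr.
by rewrite -mulrA mulrCA signrMK mulrC subrr scale0r.
Qed.

(** Each i in J contributes f J with a squared sign, so the eigenvalue on the coordinate J is
    #|J|. *)
Lemma ext_number n f : (forall I, #|I| <> n -> f I = 0) ->
  \sum_(i < m) ext_eps i (ext_iota i f) = n%:R *: f.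
Proof.
move=> fn; apply/ffunP => J; rewrite sum_ffunE [RHS]ffunE.
under eq_bigr => i _ do rewrite ext_epsE ext_iotaE in_setD1 eqxx /=.
rewrite -big_mkcond /=.
under eq_bigr => i iJ do rewrite scalerA ext_sign_sqr scale1r setD1K //.
rewrite sumr_const -scaler_nat; have [<-//|/eqP nJ] := eqVneq #|J| n.
by rewrite fn // !scaler0.
Qed.

(** Follows from [ext_number] and the diagonal case of [ext_eps_iota]. The difference m - n is taken
    in the field, not truncated. *)
Lemma ext_conumber n f : (forall I, #|I| <> n -> f I = 0) ->
  \sum_(i < m) ext_iota i (ext_eps i f) = (m%:R - n%:R) *: f.
Proof.
move=> fn; rewrite scalerBl -(ext_number fn) -[m in m%:R]card_ord scaler_nat.
rewrite -sumr_const -sumrB.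
apply: eq_bigr => i _; apply/eqP; rewrite eq_sym subr_eq addrC ext_eps_iota.
by rewrite eqxx scale1r.
Qed.

End Clifford.

(** All six anticommutators of d, e, x, y are instances, with A, B acting on forms, P, Q on
    coefficients, and a, b in {0, 1}. Moving P past Q costs the b term, and collecting the rest
    leaves {A_i, B_j} applied to Q_j P_i. *)
Lemma anticomm_sum (K : nzRingType) (V : lmodType K) (m : nat)
    (A B P Q : 'I_m -> {linear V -> V}) (a b : K) :
    (forall i j f, A i (B j f) + B j (A i f) = ((i == j)%:R * a) *: f) ->
    (forall i j f, P i (Q j f) = Q j (P i f) + ((i == j)%:R * b) *: f) ->
    (forall i j f, P i (B j f) = B j (P i f)) ->
    (forall i j f, Q j (A i f) = A i (Q j f)) ->
  forall f, \sum_i A i (P i (\sum_j B j (Q j f))) + \sum_j B j (Q j (\sum_i A i (P i f)))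
    = a *: (\sum_i Q i (P i f)) + b *: (\sum_i A i (B i f)).
Proof.
move=> AB PQ PB QA f.
have delta c (g : 'I_m -> V) i : \sum_j ((i == j)%:R * c) *: g j = c *: g i.
  rewrite (bigD1 i) //= eqxx mul1r big1 ?addr0 // => j ji.
  by rewrite eq_sym (negbTE ji) mul0r scale0r.
under [X in _ + X]eq_bigr => j _ do rewrite !linear_sum.
rewrite [X in _ + X]exchange_big !scaler_sumr -!big_split /=.
apply: eq_bigr => i _; rewrite !linear_sum -big_split /=.
(* Kronecker deltas turn the right side into sums over j as well, so both sides can be compared term
   by term. *)
rewrite -(delta a (fun j => Q j (P i f))) -(delta b (fun j => A i (B j f))).
rewrite -big_split; apply: eq_bigr => j _ /=.
rewrite PB PQ !linearD !linearZ /= QA addrAC; congr (_ + _).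
exact: AB.
Qed.

(** * Anticommutation relations *)

Section SuperRelations.
Context (m : nat) (C : numClosedFieldType) (q : C).
Implicit Types (f g : extpoly m C) (i j : 'I_m) (k : 'I_(m + m)).

Definition ext_raise k f : extpoly m C := [ffun I => raise q k (f I)].

Lemma ext_raise_is_linear k : linear (ext_raise k).
Proof. by move=> c f g; apply/ffunP => J; rewrite !ffunE linearP. Qed.

HB.instance Definition _ k := GRing.isLinear.Build C (extpoly m C) (extpoly m C) _
  (ext_raise k) (ext_raise_is_linear k).

Definition Xq f : extpoly m C := \sum_(i < m) ext_iota i (ext_raise (lshift m i) f).

Definition Xq_dag f : extpoly m C := \sum_(i < m) ext_eps i (ext_raise (rshift m i) f).

Lemma Xq_is_linear : linear Xq.
Proof.
move=> c f g; rewrite scaler_sumr -big_split; apply: eq_bigr => i _ /=.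
by rewrite !linearP.
Qed.
Lemma Xq_dag_is_linear : linear Xq_dag.
Proof.
move=> c f g; rewrite scaler_sumr -big_split; apply: eq_bigr => i _ /=.
by rewrite !linearP.
Qed.
HB.instance Definition _ := GRing.isLinear.Build C (extpoly m C) (extpoly m C) _
  Xq Xq_is_linear.
HB.instance Definition _ := GRing.isLinear.Build C (extpoly m C) (extpoly m C) _
  Xq_dag Xq_dag_is_linear.

Lemma ext_jackson_eps k i f :
  ext_jackson q k (ext_eps i f) = ext_eps i (ext_jackson q k f).
Proof.
apply/ffunP => J; rewrite !ffunE linear_sum; apply: eq_bigr => I _.
by rewrite linearZ ffunE.
Qed.
Lemma ext_jackson_iota k i f :
  ext_jackson q k (ext_iota i f) = ext_iota i (ext_jackson q k f).
Proof.
apply/ffunP => J; rewrite !ffunE linear_sum; apply: eq_bigr => I _.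
by rewrite linearZ ffunE.
Qed.
Lemma ext_raise_eps k i f : ext_raise k (ext_eps i f) = ext_eps i (ext_raise k f).
Proof.
apply/ffunP => J; rewrite !ffunE linear_sum; apply: eq_bigr => I _.
by rewrite linearZ ffunE.
Qed.
Lemma ext_raise_iota k i f : ext_raise k (ext_iota i f) = ext_iota i (ext_raise k f).
Proof.
apply/ffunP => J; rewrite !ffunE linear_sum; apply: eq_bigr => I _.
by rewrite linearZ ffunE.
Qed.

Lemma ext_raise_bihomog k r s f I : is_bihomog r s (f I) ->
  is_bihomog (r + zdeg U_(k)) (s + wdeg U_(k)) (ext_raise k f I).
Proof. by rewrite ffunE; apply: raise_bihomog. Qed.

Lemma Xq_bihom r s n f : is_bihomform r s n f -> is_bihomform r.+1 s n.-1 (Xq f).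
Proof.
move=> /is_bihomformP hf; apply: rpred_sum => i _; apply/is_bihomformP => J.
rewrite ext_iotaE; case: ifP => iJ.
  by split=> //; rewrite /is_bihomog !rpred0.
have /(ext_raise_bihomog (lshift m i)) := (hf (i |: J)).1.
rewrite zdeg_z wdeg_z addn1 addn0 => /andP[? ?]; split=> [|nJ].
  by apply/andP; split; apply: rpredZ.
rewrite ffunE (hf _).2 ?linear0 ?scaler0 // cardsU1 iJ => nJ'.
by rewrite -nJ' in nJ.
Qed.

Lemma Xq_dag_bihom r s n f : is_bihomform r s n f -> is_bihomform r s.+1 n.+1 (Xq_dag f).
Proof.
move=> /is_bihomformP hf; apply: rpred_sum => i _; apply/is_bihomformP => J.
rewrite ext_epsE; case: ifP => iJ; last first.
  by split=> //; rewrite /is_bihomog !rpred0.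
have /(ext_raise_bihomog (rshift m i)) := (hf (J :\ i)).1.
rewrite zdeg_w wdeg_w addn1 addn0 => /andP[? ?]; split=> [|nJ].
  by apply/andP; split; apply: rpredZ.
rewrite ffunE (hf _).2 ?linear0 ?scaler0 // => nJ'.
by rewrite (cardsD1 i J) iJ nJ' in nJ.
Qed.

Lemma Dq_zdeg0 s n f : is_bihomform 0 s n f -> Dq q f = 0.
Proof.
move=> /is_bihomformP hf; apply: big1 => i _.
suff -> : ext_jackson q (lshift m i) f = 0 by rewrite linear0.
by apply/ffunP => I; rewrite !ffunE (jackson_zdeg0 _ _ (hf I).1).
Qed.

Lemma Dq_dag_wdeg0 r n f : is_bihomform r 0 n f -> Dq_dag q f = 0.
Proof.
move=> /is_bihomformP hf; apply: big1 => i _.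
suff -> : ext_jackson q (rshift m i) f = 0 by rewrite linear0.
by apply/ffunP => I; rewrite !ffunE (jackson_wdeg0 _ _ (hf I).1).
Qed.

Lemma ext_iota0 i f : (forall I : {set 'I_m}, #|I| <> 0%N -> f I = 0) -> ext_iota i f = 0.
Proof.
move=> hf; apply/ffunP => J; rewrite ext_iotaE [RHS]ffunE; case: ifP => // iJ.
by rewrite hf ?scaler0 // cardsU1 iJ.
Qed.

Lemma Dq_dag_form0 r s f : is_bihomform r s 0 f -> Dq_dag q f = 0.
Proof.
move=> /is_bihomformP hf; apply: big1 => i _; apply: ext_iota0 => I nI.
by rewrite ffunE (hf I).2 // linear0.
Qed.

Lemma Xq_form0 r s f : is_bihomform r s 0 f -> Xq f = 0.
Proof.
move=> /is_bihomformP hf; apply: big1 => i _; apply: ext_iota0 => I nI.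
by rewrite ffunE (hf I).2 // linear0.
Qed.

Let epsL i : {linear extpoly m C -> extpoly m C} := ext_eps i.
Let iotaL i : {linear extpoly m C -> extpoly m C} := ext_iota i.
Let jackL (h : 'I_m -> 'I_(m + m)) i : {linear extpoly m C -> extpoly m C} :=
  ext_jackson q (h i).
Let raiseL (h : 'I_m -> 'I_(m + m)) i : {linear extpoly m C -> extpoly m C} :=
  ext_raise (h i).

Lemma iota_eps_comm i j f :
  ext_iota i (ext_eps j f) + ext_eps j (ext_iota i f) = (i == j)%:R *: f.
Proof. by rewrite addrC ext_eps_iota eq_sym. Qed.

Lemma ext_jacksonC k k' f :
  ext_jackson q k (ext_jackson q k' f) = ext_jackson q k' (ext_jackson q k f).
Proof.
have E k1 k2 : ext_jackson q k1 (ext_jackson q k2 f) =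
    [ffun I => jackson q k1 (jackson q k2 (f I))].
  by apply/ffunP => I; rewrite !ffunE.
apply: etrans (E k k') _; apply: etrans _ (esym (E k' k)).
by apply/ffunP => I; rewrite [LHS]ffunE [RHS]ffunE; apply: jacksonC.
Qed.

(** Applied to one operator twice, [anticomm_sum] gives double its square; characteristic zero
    removes the factor 2. *)
Lemma double_eq0 f : f + f = 0 -> f = 0.
Proof.
move/eqP; rewrite -mulr2n -scaler_nat scaler_eq0 pnatr_eq0 /=.
by move/eqP.
Qed.

Lemma Dq_Dq f : Dq q (Dq q f) = 0.
Proof.
apply: double_eq0.
have := @anticomm_sum _ _ _ epsL epsL (jackL (lshift m)) (jackL (lshift m)) 0 0.
rewrite /= => ->; rewrite ?scale0r ?addr0 // => i j g.
- by rewrite ext_eps_anticomm mulr0 scale0r.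
- by rewrite ext_jacksonC mulr0 scale0r addr0.
- exact: ext_jackson_eps.
- exact: ext_jackson_eps.
Qed.

Lemma Dq_dag_Dq_dag f : Dq_dag q (Dq_dag q f) = 0.
Proof.
apply: double_eq0.
have := @anticomm_sum _ _ _ iotaL iotaL (jackL (@rshift m m)) (jackL (@rshift m m)) 0 0.
rewrite /= => ->; rewrite ?scale0r ?addr0 // => i j g.
- by rewrite ext_iota_anticomm mulr0 scale0r.
- by rewrite ext_jacksonC mulr0 scale0r addr0.
- exact: ext_jackson_iota.
- exact: ext_jackson_iota.
Qed.

Hypothesis q_torsionfree : forall k : nat, q ^+ k.+1 != 1.

Lemma ext_jackson_raise k k' f :
  ext_jackson q k (ext_raise k' f) = ext_raise k' (ext_jackson q k f) + (k == k')%:R *: f.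
Proof. by apply/ffunP => I; rewrite !ffunE (jackson_raise q_torsionfree). Qed.

Lemma Dq_Xq_dag f : Dq q (Xq_dag f) = - Xq_dag (Dq q f).
Proof.
apply/eqP; rewrite -addr_eq0; apply/eqP.
have := @anticomm_sum _ _ _ epsL epsL (jackL (lshift m)) (raiseL (@rshift m m)) 0 0.
rewrite /= => ->; rewrite ?scale0r ?addr0 // => i j g.
- by rewrite ext_eps_anticomm mulr0 scale0r.
- by rewrite ext_jackson_raise eq_lrshift mulr0.
- exact: ext_jackson_eps.
- exact: ext_raise_eps.
Qed.

Lemma Dq_dag_Xq f : Dq_dag q (Xq f) = - Xq (Dq_dag q f).
Proof.
apply/eqP; rewrite -addr_eq0; apply/eqP.
have := @anticomm_sum _ _ _ iotaL iotaL (jackL (@rshift m m)) (raiseL (lshift m)) 0 0.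
rewrite /= => ->; rewrite ?scale0r ?addr0 // => i j g.
- by rewrite ext_iota_anticomm mulr0 scale0r.
- by rewrite ext_jackson_raise eq_rlshift mulr0.
- exact: ext_jackson_iota.
- exact: ext_raise_iota.
Qed.

(** The anticommutator is the Euler operator in z, with eigenvalue r, plus the form-degree operator,
    with eigenvalue n. *)
Lemma Dq_Xq r s n f : is_bihomform r s n f ->
  Dq q (Xq f) + Xq (Dq q f) = (r%:R + n%:R) *: f.
Proof.
move=> /is_bihomformP hf.
have := @anticomm_sum _ _ _ epsL iotaL (jackL (lshift m)) (raiseL (lshift m)) 1 1.
rewrite /= => ->; first last.
- by move=> *; apply: ext_raise_eps.
- by move=> *; apply: ext_jackson_iota.
- by move=> i j g; rewrite ext_jackson_raise (inj_eq (@lshift_inj _ _)) mulr1.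
- by move=> i j g; rewrite ext_eps_iota mulr1.
rewrite !scale1r (ext_number (n := n)) => [|I]; last exact: (hf I).2.
rewrite scalerDl; congr (_ + _); apply/ffunP => I.
rewrite sum_ffunE [RHS]ffunE -(euler_z q_torsionfree (hf I).1).
by apply: eq_bigr => i _; rewrite !ffunE.
Qed.

(** Here the Euler operator in w gives s, and the reversed order of contraction and exterior product
    gives m - n. *)
Lemma Dq_dag_Xq_dag r s n f : is_bihomform r s n f ->
  Dq_dag q (Xq_dag f) + Xq_dag (Dq_dag q f) = (s%:R + (m%:R - n%:R)) *: f.
Proof.
move=> /is_bihomformP hf.
have := @anticomm_sum _ _ _ iotaL epsL (jackL (@rshift m m)) (raiseL (@rshift m m)) 1 1.
rewrite /= => ->; first last.
- by move=> *; apply: ext_raise_iota.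
- by move=> *; apply: ext_jackson_eps.
- by move=> i j g; rewrite ext_jackson_raise (inj_eq (@rshift_inj _ _)) mulr1.
- by move=> i j g; rewrite iota_eps_comm mulr1.
rewrite !scale1r (ext_conumber (n := n)) => [|I]; last exact: (hf I).2.
rewrite [RHS]scalerDl; congr (_ + _); apply/ffunP => I.
rewrite sum_ffunE [RHS]ffunE -(euler_w q_torsionfree (hf I).1).
by apply: eq_bigr => i _; rewrite !ffunE.
Qed.

End SuperRelations.

(** * Preimages from the anticommutation relations *)

Section Superalgebra.
Context (K : numFieldType) (V : lmodType K) (m : nat) (d e x y : {linear V -> V}).
(** [G r s n] plays the role of P_(r,s)^n. A predicate on one space, in place of a family of types,
    avoids casts between degrees. *)
Context (G : nat -> nat -> nat -> V -> Prop).
Implicit Types (f g u : V) (r s n : nat).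

Hypothesis G0 : forall r s n, G r s n 0.
Hypothesis GP : forall r s n c f g, G r s n f -> G r s n g -> G r s n (c *: f + g).
Hypothesis Gd : forall r s n f, G r s n f -> G r.-1 s n.+1 (d f).
Hypothesis Ge : forall r s n f, G r s n f -> G r s.-1 n.-1 (e f).
Hypothesis Gx : forall r s n f, G r s n f -> G r.+1 s n.-1 (x f).
Hypothesis Gy : forall r s n f, G r s n f -> G r s.+1 n.+1 (y f).
(** The predecessors in [Gd], [Ge] and [Gx] truncate at degree 0; these vanishing conditions settle
    those boundary cases. *)
Hypothesis d_r0 : forall s n f, G 0 s n f -> d f = 0.
Hypothesis e_s0 : forall r n f, G r 0 n f -> e f = 0.
Hypothesis e_n0 : forall r s f, G r s 0 f -> e f = 0.
Hypothesis x_n0 : forall r s f, G r s 0 f -> x f = 0.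
Hypothesis dd : forall f, d (d f) = 0.
Hypothesis ee : forall f, e (e f) = 0.
Hypothesis dy : forall f, d (y f) = - y (d f).
Hypothesis ex : forall f, e (x f) = - x (e f).
Hypothesis dx : forall r s n f, G r s n f -> d (x f) + x (d f) = (r%:R + n%:R) *: f.
Hypothesis ey : forall r s n f, G r s n f ->
  e (y f) + y (e f) = (s%:R + (m%:R - n%:R)) *: f.

Definition lap f := d (e f) + e (d f).
Definition rho f := x (y f) + y (x f).

Lemma lap_is_linear : linear lap.
Proof. by move=> c f g; rewrite /lap !linearP scalerDr addrACA. Qed.
Lemma rho_is_linear : linear rho.
Proof. by move=> c f g; rewrite /rho !linearP scalerDr addrACA. Qed.
HB.instance Definition _ := GRing.isLinear.Build K V V _ lap lap_is_linear.
HB.instance Definition _ := GRing.isLinear.Build K V V _ rho rho_is_linear.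

Lemma GD r s n f g : G r s n f -> G r s n g -> G r s n (f + g).
Proof. by move=> Gf; rewrite -[f]scale1r; apply: GP. Qed.

Lemma GZ r s n c f : G r s n f -> G r s n (c *: f).
Proof. by move=> Gf; rewrite -[_ *: _]addr0; apply: GP. Qed.

Lemma Glap r s n f : G r s n f -> G r.-1 s.-1 n (lap f).
Proof.
move=> Gf; apply: GD; last by have := Ge (Gd Gf).
(* For n = 0 the degree [n.-1.+1] is not n, but then e f = 0. *)
case: n Gf => [|n] Gf; last by have := Gd (Ge Gf).
by rewrite (e_n0 Gf) linear0.
Qed.

Lemma Grho r s n f : G r s n f -> G r.+1 s.+1 n (rho f).
Proof.
move=> Gf; apply: GD; first by have := Gx (Gy Gf).
case: n Gf => [|n] Gf; last by have := Gy (Gx Gf).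
by rewrite (x_n0 Gf) linear0.
Qed.

Lemma dxE r s n f : G r s n f -> d (x f) = (r%:R + n%:R) *: f - x (d f).
Proof. by move=> Gf; rewrite -(dx Gf) addrK. Qed.

Lemma eyE r s n f : G r s n f -> e (y f) = (s%:R + (m%:R - n%:R)) *: f - y (e f).
Proof. by move=> Gf; rewrite -(ey Gf) addrK. Qed.

(** Expands an operator on an element of the shape of the primitive built in [d_surj]. *)
Lemma linear_comb3 (T : {linear V -> V}) (a b c : K) f g u :
  T (a *: f + b *: (g - c *: u)) = a *: T f + b *: (T g - c *: T u).
Proof.
rewrite linearD [T (a *: _)]linearZ [T (b *: _)]linearZ linearB.
by rewrite [T (c *: _)]linearZ.
Qed.

(** Common last step of the commutators [lap, x] = e, [lap, y] = d and [d, rho] = y: eigenvalues at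
    neighbouring degrees differ by 1, which leaves one copy of [a]. *)
Lemma addr_scaler_shift (a b c : V) (w w' : K) : w = w' + 1 ->
  (w *: a + b) + (c - w' *: a) = (b + c) + a.
Proof.
move=> ->; rewrite [_ *: a + b]addrC addrACA -scalerBl.
by rewrite [w' + 1]addrC addrK scale1r.
Qed.

Lemma lap_x r s n f : G r s n f -> lap (x f) = x (lap f) + e f.
Proof.
move=> Gf; rewrite /lap ex linearN /= (dxE Gf) linearB linearZ /= ex opprK linearD.
case: n Gf => [|n] Gf /=.
  by rewrite (e_n0 Gf) !(linear0, scaler0, addr0, oppr0, add0r).
rewrite (dxE (Ge Gf)) opprB addrC [x _ + x _]addrC; apply: addr_scaler_shift.
by rewrite -natr1 addrA.
Qed.

Lemma lap_y r s n f : G r s n f -> lap (y f) = y (lap f) + d f.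
Proof.
move=> Gf; rewrite /lap dy linearN /= (eyE Gf) (eyE (Gd Gf)) linearB linearZ /=.
rewrite dy opprK opprB linearD; apply: addr_scaler_shift.
by rewrite -natr1; ring.
Qed.

(** By [lap, x] = e and [lap, y] = d, the commutator [lap, rho] is {d, x} + {e, y}; in the sum of
    the eigenvalues r + n and s + m - n the form degree cancels. *)
Lemma lap_rho r s n f : G r s n f ->
  lap (rho f) = rho (lap f) + (r + s + m)%:R *: f.
Proof.
move=> Gf; rewrite [rho f]/rho linearD /= (lap_x (Gy Gf)) (lap_y (Gx Gf)).
rewrite (lap_x Gf) (lap_y Gf); move: (lap f) => L; rewrite !linearD /= /rho.
rewrite -(addrA (x (y L))) -(addrA (y (x L))) addrACA; congr (_ + _).
have -> : (r + s + m)%:R = (r%:R + n%:R) + (s%:R + (m%:R - n%:R)) :> K.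
  by rewrite !natrD; ring.
rewrite scalerDl -(dx Gf) -(ey Gf).
by rewrite [y (e f) + _]addrC addrACA [x (d f) + _]addrC.
Qed.

Lemma d_rho r s n f : G r s n f -> d (rho f) = rho (d f) + y f.
Proof.
move=> Gf; rewrite /rho linearD /= dy (dxE Gf) (dxE (Gy Gf)) dy linearN opprK.
rewrite linearB linearZ opprB; apply: addr_scaler_shift.
by rewrite -natr1 addrA.
Qed.

Lemma lap_r0 s n f : G 0 s n f -> lap f = 0.
Proof. by move=> Gf; rewrite /lap (d_r0 (Ge Gf)) (d_r0 Gf) linear0 addr0. Qed.

Lemma lap_s0 r n f : G r 0 n f -> lap f = 0.
Proof. by move=> Gf; rewrite /lap (e_s0 (Gd Gf)) (e_s0 Gf) linear0 addr0. Qed.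

(* [lap \o rho = rho \o lap + (r + s + m)], so solving with [w] in bidegree
   (r, s) reduces to solving with [w + (r - 1 + s - 1 + m)] in bidegree
   (r - 1, s - 1). *)
Lemma rho_lap_shift_surj r s n (w : K) f : 0 < w -> G r s n f ->
  exists2 g, G r s n g & rho (lap g) + w *: g = f.
Proof.
elim: r s w f => [|r IHr] [|s] w f w0 Gf; try by
  exists (w^-1 *: f); [exact: GZ | rewrite linearZ /= ?(lap_r0 Gf) ?(lap_s0 Gf)
    scaler0 linear0 add0r scalerA divff ?gt_eqF ?scale1r].
have w'0 : 0 < w + (r + s + m)%:R by apply: ltr_wpDr.
have [u Gu uE] := IHr s _ (lap f) w'0 (Glap Gf).
(* Applying [lap] to the equation shows that lap g should solve the shifted equation, so lap g = u
   is imposed and the equation is solved for g. *)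
exists (w^-1 *: (f - rho u)).
  by apply: GZ; rewrite addrC -scaleN1r; apply: GP => //; apply: Grho.
rewrite [lap (_ *: _)]linearZ [rho (_ *: _)]linearZ /= scalerA divff ?gt_eqF //.
rewrite scale1r linearB /= (lap_rho Gu).
have -> : lap f - (rho (lap u) + (r + s + m)%:R *: u) = w *: u.
  by apply/eqP; rewrite subr_eq -uE scalerDl addrCA.
by rewrite linearZ /= scalerA mulVf ?gt_eqF // scale1r addrC subrK.
Qed.

Hypothesis m_gt0 : (0 < m)%N.

(** On bidegree (r, s), lap rho = rho lap + (r + s + m), so the shifted equation with w = r + s + m
    makes [rho g] a preimage; m > 0 ensures w > 0. *)
Lemma lap_surj r s n f : G r s n f -> exists2 g, G r.+1 s.+1 n g & lap g = f.
Proof.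
move=> Gf; have w0 : 0 < (r + s + m)%:R :> K by rewrite ltr0n addn_gt0 m_gt0 orbT.
have [g Gg <-] := rho_lap_shift_surj w0 Gf.
by exists (rho g); [exact: Grho | rewrite (lap_rho Gg)].
Qed.

Lemma lap_d f : lap (d f) = d (lap f).
Proof. by rewrite /lap dd linear0 addr0 linearD /= dd add0r. Qed.

(* The naive primitive [x f] is not harmonic: its Laplacian is [e f]. The other
   two terms, whose [d]-images cancel, correct this. *)
Lemma d_surj r s n f : (0 < r + n)%N -> G r s n.+1 f -> d f = 0 -> lap f = 0 ->
  exists2 g, G r.+1 s n g & lap g = 0 /\ d g = f.
Proof.
move=> rn Gf df lf; pose u := e f.
have Gu : G r s.-1 n u by have := Ge Gf.
have eu : e u = 0 by apply: ee.
have du : d u = 0 by have := lf; rewrite /lap df linear0 addr0.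
have lu : lap u = 0 by rewrite /lap eu du !linear0 addr0.
(* If s = 0 then u = 0, so scalars in front of u need to agree only for s > 0, where [s.-1] is a
   true predecessor. *)
have s0 (c c' : K) : (0 < s -> c = c')%N -> c *: u = c' *: u.
  case: s Gf {Gu} => [|s] Gf; last by move=> ->.
  by rewrite /u (e_s0 Gf) !scaler0.
(* [A] is the eigenvalue of {d, x} on f and, for s > 0, [B] is that of {e, y} on u. *)
pose A : K := r%:R + n.+1%:R; pose B : K := s%:R - 1 + (m%:R - n%:R).
have A0 : A != 0 by rewrite /A -natrD addnS pnatr_eq0.
(* A - 1 = r + n, which is where the hypothesis 0 < r + n enters. *)
have A1 : A - 1 != 0 by rewrite /A -natr1 addrA addrK -natrD pnatr_eq0 -lt0n.
have AB : A + B != 0.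
  have -> : A + B = (r + s + m)%:R by rewrite /A /B -natr1 !natrD; ring.
  by rewrite pnatr_eq0 -lt0n addn_gt0 m_gt0 orbT.
have eyu : e (y u) = B *: u.
  rewrite (eyE Gu) eu linear0 subr0; apply: s0 => s_gt0.
  by rewrite /B -[in RHS](prednK s_gt0) -natr1; ring.
have lrho : lap (rho u) = (A + B - 1) *: u.
  rewrite (lap_rho Gu) lu linear0 add0r; apply: s0 => s_gt0.
  by rewrite /A /B -[in RHS](prednK s_gt0) -!natr1 !natrD; ring.
have Gys : G r s n.+1 (y u).
  case: s Gf Gu {s0 B AB eyu lrho} => [|s] Gf Gu; last by have := Gy Gu.
  by rewrite /u (e_s0 Gf) linear0.
have Grs : G r.+1 s n (rho u).
  case: s Gf Gu {s0 B AB eyu lrho Gys} => [|s] Gf Gu; last by have := Grho Gu.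
  by rewrite /u (e_s0 Gf) linear0.
pose c := (A * (A - 1) * (A + B))^-1.
exists (A^-1 *: x f + c *: (x (y u) - A *: rho u)).
  apply: GP; first exact: (Gx Gf).
  by apply/GZ; rewrite addrC -scaleNr; apply: GP => //; apply: (Gx Gys).
split.
  rewrite linear_comb3 /= lrho (lap_x Gf) lf linear0 add0r.
  rewrite (lap_x Gys) (lap_y Gu) lu du !linear0 addr0 linear0 add0r eyu -/u.
  rewrite scalerA -scalerBl scalerA -scalerDl; apply/eqP; rewrite scaler_eq0.
  by apply/orP; left; apply/eqP; rewrite /c; field; rewrite A0 A1 AB.
rewrite linear_comb3 /= (dxE Gf) (dxE Gys) df dy du (d_rho Gu) du.
by rewrite !(linear0, oppr0, subr0, add0r) subrr scaler0 addr0 scalerA mulVf ?scale1r.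
Qed.

(** The element y f divided by the eigenvalue s + m - n of {e, y} suffices: d y f = - y d f = 0, and
    the Laplacian of the quotient is d f = 0. *)
Lemma e_surj r s n f : (n < s + m)%N -> G r s n f -> d f = 0 -> e f = 0 ->
  exists2 g, G r s.+1 n.+1 g & [/\ d g = 0, lap g = 0 & e g = f].
Proof.
move=> nsm Gf df ef; pose c : K := s%:R + (m%:R - n%:R).
have c0 : c != 0.
  by rewrite /c addrA -natrD -natrB ?(ltnW nsm) // pnatr_eq0 -lt0n subn_gt0.
have eyf : e (c^-1 *: y f) = f.
  by rewrite linearZ /= (eyE Gf) ef linear0 subr0 scalerA mulVf ?scale1r.
have dyf : d (c^-1 *: y f) = 0 by rewrite linearZ /= dy df linear0 oppr0 scaler0.
exists (c^-1 *: y f); first by apply/GZ/Gy.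
by split=> //; rewrite /lap eyf dyf df linear0 addr0.
Qed.

End Superalgebra.

(** * Surjectivity for the Jackson operators *)

Section Surjectivity.
Context (m : nat) (C : numClosedFieldType) (q : C).
Hypothesis m_gt0 : (0 < m)%N.
Hypothesis q_torsionfree : forall k : nat, q ^+ k.+1 != 1.
Implicit Types (r s n : nat) (f g : extpoly m C).

Definition lapq f : extpoly m C := @lap C (extpoly m C) (Dq q) (Dq_dag q) f.

Lemma lapqE f : lapq f = Dq q (Dq_dag q f) + Dq_dag q (Dq q f).
Proof. by []. Qed.

Lemma lapq_is_linear : linear lapq.
Proof. exact: lap_is_linear. Qed.
HB.instance Definition _ := GRing.isLinear.Build C (extpoly m C) (extpoly m C) _
  lapq lapq_is_linear.

Let G r s n f : Prop := is_bihomform r s n f.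
Let G0 r s n : G r s n 0 := (is_bihomform_submod m C r s n).1.
Let GP r s n c f g : G r s n f -> G r s n g -> G r s n (c *: f + g).
Proof. exact: (is_bihomform_submod m C r s n).2. Qed.
Let Gd r s n f : G r s n f -> G r.-1 s n.+1 (Dq q f) := @Dq_bihom m C q r s n f.
Let Ge r s n f : G r s n f -> G r s.-1 n.-1 (Dq_dag q f) := @Dq_dag_bihom m C q r s n f.
Let Gx r s n f : G r s n f -> G r.+1 s n.-1 (Xq q f) := @Xq_bihom m C q r s n f.
Let Gy r s n f : G r s n f -> G r s.+1 n.+1 (Xq_dag q f) := @Xq_dag_bihom m C q r s n f.
Let d_r0 s n f : G 0 s n f -> Dq q f = 0 := @Dq_zdeg0 m C q s n f.
Let e_s0 r n f : G r 0 n f -> Dq_dag q f = 0 := @Dq_dag_wdeg0 m C q r n f.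
Let e_n0 r s f : G r s 0 f -> Dq_dag q f = 0 := @Dq_dag_form0 m C q r s f.
Let x_n0 r s f : G r s 0 f -> Xq q f = 0 := @Xq_form0 m C q r s f.
Let dy f : Dq q (Xq_dag q f) = - Xq_dag q (Dq q f) := Dq_Xq_dag q_torsionfree f.
Let ex f : Dq_dag q (Xq q f) = - Xq q (Dq_dag q f) := Dq_dag_Xq q_torsionfree f.
Let dx r s n f : G r s n f -> Dq q (Xq q f) + Xq q (Dq q f) = (r%:R + n%:R) *: f :=
  @Dq_Xq m C q q_torsionfree r s n f.
Let ey r s n f : G r s n f ->
  Dq_dag q (Xq_dag q f) + Xq_dag q (Dq_dag q f) = (s%:R + (m%:R - n%:R)) *: f :=
  @Dq_dag_Xq_dag m C q q_torsionfree r s n f.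

Lemma lapq_bihom r s n f : is_bihomform r s n f -> is_bihomform r.-1 s.-1 n (lapq f).
Proof. exact: (Glap G0 GP Gd Ge e_n0). Qed.

Lemma lapq_zdeg0 s n f : is_bihomform 0 s n f -> lapq f = 0.
Proof. exact: (lap_r0 Ge d_r0). Qed.

Lemma lapq_wdeg0 r n f : is_bihomform r 0 n f -> lapq f = 0.
Proof. exact: (lap_s0 Gd e_s0). Qed.

Lemma lapq_Dq f : lapq (Dq q f) = Dq q (lapq f).
Proof. exact: (@lap_d C (extpoly m C) (Dq q) (Dq_dag q) (@Dq_Dq m C q) f). Qed.

Lemma lapq_surj r s n f : is_bihomform r s n f ->
  exists2 g, is_bihomform r.+1 s.+1 n g & lapq g = f.
Proof. exact: (lap_surj G0 GP Gd Ge Gx Gy d_r0 e_s0 e_n0 x_n0 dy ex dx ey). Qed.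

Lemma Dq_surj r s n f : (0 < r + n)%N -> is_bihomform r s n.+1 f ->
  Dq q f = 0 -> lapq f = 0 ->
  exists2 g, is_bihomform r.+1 s n g & lapq g = 0 /\ Dq q g = f.
Proof.
exact: (d_surj G0 GP Gd Ge Gx Gy e_s0 e_n0 x_n0 (Dq_dag_Dq_dag q) dy ex dx ey).
Qed.

Lemma Dq_dag_surj r s n f : (n < s + m)%N -> is_bihomform r s n f ->
  Dq q f = 0 -> Dq_dag q f = 0 ->
  exists2 g, is_bihomform r s.+1 n.+1 g &
    [/\ Dq q g = 0, lapq g = 0 & Dq_dag q g = f].
Proof. exact: (e_surj G0 GP Gy dy ey). Qed.

End Surjectivity.

(** * Dimension recursions from rank-nullity *)

Section RankNullity.
Context (m : nat) (C : numClosedFieldType) (q : C).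
Hypothesis m_gt0 : (0 < m)%N.
Hypothesis q_torsionfree : forall k : nat, q ^+ k.+1 != 1.
Implicit Types (r s n : nat).

Definition lapq_rs r s n (f : bihomform m C r s n) : bihomform m C r.-1 s.-1 n :=
  Bihomform (lapq_bihom q (bihomformP f)).

Lemma lapq_rs_is_linear r s n : linear (@lapq_rs r s n).
Proof. by move=> c f g; apply/val_inj; rewrite /= linearP. Qed.
HB.instance Definition _ r s n :=
  GRing.isLinear.Build C (bihomform m C r s n) (bihomform m C r.-1 s.-1 n) _
    (@lapq_rs r s n) (@lapq_rs_is_linear r s n).

Definition harmonic r s n : {vspace bihomform m C r s n} :=
  lker (linfun (@lapq_rs r s n)).

Definition closed_harmonic r s n : {vspace bihomform m C r s n} :=
  (harmonic r s n :&: lker (linfun (@Dq_rs m C q r s n)))%VS.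

Lemma memv_harmonic r s n (f : bihomform m C r s n) :
  (f \in harmonic r s n) = (lapq q f == 0).
Proof. by rewrite memv_ker lfunE. Qed.

Lemma memv_closed_harmonic r s n (f : bihomform m C r s n) :
  (f \in closed_harmonic r s n) = (lapq q f == 0) && (Dq q f == 0).
Proof. by rewrite memv_cap memv_harmonic memv_ker lfunE. Qed.

(** Rank-nullity for the restriction of T to U, whose image is W by the last two hypotheses. *)
Lemma dim_ker_surj (vT wT : vectType C) (T : {linear vT -> wT}) (U K : {vspace vT})
    (W : {vspace wT}) :
    (U :&: lker (linfun T) = K)%VS ->
    (forall f, f \in U -> T f \in W) ->
    (forall g, g \in W -> exists2 f, f \in U & T f = g) ->
  (\dim K + \dim W = \dim U)%N.
Proof.
move=> <- TU WT; rewrite -(limg_ker_dim (linfun T) U); congr (_ + \dim _)%N.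
apply/eqP; rewrite eqEsubv; apply/andP; split; apply/subvP => g.
  by case/WT => f fU <-; rewrite -[T f](lfunE T); apply: memv_img.
by case/memv_imgP => f fU ->; rewrite lfunE; apply: TU.
Qed.

Lemma dim_harmonicS r s n :
  (\dim (harmonic r.+1 s.+1 n) + \dim {:bihomform m C r s n}
     = \dim {:bihomform m C r.+1 s.+1 n})%N.
Proof.
apply: (@dim_ker_surj _ _ (@lapq_rs r.+1 s.+1 n)); first exact: capfv.
  by move=> *; apply: memvf.
move=> g _; have [f hf lf] := lapq_surj m_gt0 q_torsionfree (bihomformP g).
by exists (Bihomform hf); [exact: memvf | exact/val_inj].
Qed.

Lemma dim_harmonic_zdeg0 s n :
  \dim (harmonic 0 s n) = \dim {:bihomform m C 0 s n}.
Proof.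
congr (\dim _); apply/vspaceP => f.
by rewrite memv_harmonic memvf (lapq_zdeg0 _ (bihomformP f)) eqxx.
Qed.

Lemma dim_harmonic_wdeg0 r n :
  \dim (harmonic r 0 n) = \dim {:bihomform m C r 0 n}.
Proof.
congr (\dim _); apply/vspaceP => f.
by rewrite memv_harmonic memvf (lapq_wdeg0 _ (bihomformP f)) eqxx.
Qed.

Lemma dim_closed_harmonicS r s n : (0 < r + n)%N ->
  (\dim (closed_harmonic r.+1 s n) + \dim (closed_harmonic r s n.+1)
     = \dim (harmonic r.+1 s n))%N.
Proof.
move=> rn; apply: (@dim_ker_surj _ _ (@Dq_rs m C q r.+1 s n)) => //.
  move=> f; rewrite memv_harmonic => /eqP lf.
  by rewrite memv_closed_harmonic /= lapq_Dq lf linear0 Dq_Dq eqxx.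
move=> g; rewrite memv_closed_harmonic => /andP[/eqP lg /eqP dg].
have [f hf [lf df]] := Dq_surj m_gt0 q_torsionfree rn (bihomformP g) dg lg.
by exists (Bihomform hf); [rewrite memv_harmonic lf | exact/val_inj].
Qed.

Lemma dim_closed_harmonic_zdeg0 s n :
  \dim (closed_harmonic 0 s n) = \dim {:bihomform m C 0 s n}.
Proof.
congr (\dim _); apply/vspaceP => f; rewrite memv_closed_harmonic memvf.
by rewrite (lapq_zdeg0 _ (bihomformP f)) (Dq_zdeg0 _ (bihomformP f)) eqxx.
Qed.

Lemma dim_monogenicS r s n : (n < s + m)%N ->
  (\dim (monogenic m q r s.+1 n.+1) + \dim (monogenic m q r s n)
     = \dim (closed_harmonic r s.+1 n.+1))%N.
Proof.
move=> nsm; apply: (@dim_ker_surj _ _ (@Dq_dag_rs m C q r s.+1 n.+1)).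
- apply/vspaceP => f; rewrite memv_cap memv_closed_harmonic memv_monogenic.
  rewrite memv_ker lfunE -[X in _ && X]/(Dq_dag q f == 0) -andbA.
  (* Harmonicity is automatic once both first-order operators annihilate f. *)
  apply: andb_idl => /andP[/eqP df /eqP ef].
  by rewrite lapqE df ef !linear0 addr0.
- move=> f; rewrite memv_closed_harmonic memv_monogenic => /andP[/eqP lf /eqP df].
  (* On closed elements the Laplacian reduces to d e, so e f is closed when f is also harmonic. *)
  have de : lapq q f = Dq q (Dq_dag q f) by rewrite lapqE df linear0 addr0.
  by rewrite /= -de lf Dq_dag_Dq_dag eqxx.
move=> g; rewrite memv_monogenic => /andP[/eqP dg /eqP eg].
have [f hf [df lf ef]] := Dq_dag_surj q_torsionfree nsm (bihomformP g) dg eg.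
by exists (Bihomform hf); [rewrite memv_closed_harmonic lf df eqxx | exact/val_inj].
Qed.

Lemma dim_monogenic_wdeg0 r n :
  \dim (monogenic m q r 0 n) = \dim (closed_harmonic r 0 n).
Proof.
congr (\dim _); apply/vspaceP => f; rewrite memv_closed_harmonic memv_monogenic.
by rewrite (lapq_wdeg0 _ (bihomformP f)) (Dq_dag_wdeg0 _ (bihomformP f)) eqxx andbT.
Qed.

(** On 0-forms x f = 0, so d f = 0 turns the relation for {d, x} into (r + 1) f = 0. *)
Lemma dim_monogenic_form0S r s : \dim (monogenic m q r.+1 s 0) = 0%N.
Proof.
apply/eqP; rewrite dimv_eq0 -subv0; apply/subvP => f; rewrite memv_monogenic memv0.
case/andP => /eqP df _; have := Dq_Xq q_torsionfree (bihomformP f).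
rewrite df (Xq_form0 _ (bihomformP f)) !linear0 addr0 addr0 => /esym/eqP.
by rewrite scaler_eq0 pnatr_eq0.
Qed.

Lemma dim_monogenic_form0_zdeg0 s :
  \dim (monogenic m q 0 s 0) = \dim {:bihomform m C 0 s 0}.
Proof.
congr (\dim _); apply/vspaceP => f; rewrite memv_monogenic memvf.
by rewrite (Dq_zdeg0 _ (bihomformP f)) (Dq_dag_form0 _ (bihomformP f)) eqxx.
Qed.

End RankNullity.

(** * Dimensions *)

Lemma card_degree_tuples m' r :
  #|[set t : m'.+1.-tuple 'I_r.+1 | (\sum_(i < m'.+1) tnth t i == r)%N]|
    = 'C(m' + r, r).
Proof.
rewrite -[RHS]bin_sub ?leq_addl // addnK -card_ord_partitions.
by congr #|pred_of_set _|; apply/setP => t; rewrite !inE big_tuple.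
Qed.

Lemma card_bidegree_mnm m' r s :
  #|[set u : bmultinom (m'.+1 + m'.+1) (r + s).+1 | (zdeg u == r) && (wdeg u == s)]|
    = ('C(m' + r, r) * 'C(m' + s, s))%N.
Proof.
rewrite -!card_degree_tuples -cardsX.
set D := [set u | _]; set T := setX _ _.
(* Separating the z-exponents from the w-exponents is a bijection onto pairs of tuples; [inord]
   loses nothing because each exponent is at most the degree. *)
pose h (u : bmultinom (m'.+1 + m'.+1) (r + s).+1) :
    m'.+1.-tuple 'I_r.+1 * m'.+1.-tuple 'I_s.+1 :=
  ([tuple inord (bmnm u (lshift _ i)) | i < m'.+1],
   [tuple inord (bmnm u (rshift _ i)) | i < m'.+1]).
have zle u i : u \in D -> (bmnm u (lshift _ i) < r.+1)%N.
  rewrite inE => /andP[/eqP zu _].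
  rewrite ltnS -[X in (_ <= X)%N]zu /zdeg (bigD1 i) //=.
  exact: leq_addr.
have wle u i : u \in D -> (bmnm u (rshift _ i) < s.+1)%N.
  rewrite inE => /andP[_ /eqP wu].
  rewrite ltnS -[X in (_ <= X)%N]wu /wdeg (bigD1 i) //=.
  exact: leq_addr.
have h_inj : {in D &, injective h}.
  move=> u v uD vD huv.
  have [ez ew] : (h u).1 = (h v).1 /\ (h u).2 = (h v).2 by rewrite huv.
  apply/val_inj/mnmP => k /=.
  case: (splitP k) => i ki.
    have -> : k = lshift _ i by apply/val_inj.
    have := congr1 (fun t => val (tnth t i)) ez.
    by rewrite !tnth_mktuple /= !inordK ?zle.
  have -> : k = rshift _ i by apply/val_inj.
  have := congr1 (fun t => val (tnth t i)) ew.
  by rewrite !tnth_mktuple /= !inordK ?wle.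
rewrite -(card_in_imset h_inj); congr #|pred_of_set _|; apply/setP => -[t t'].
apply/imsetP/idP => [[u uD ->]|].
  rewrite !inE; have := uD; rewrite inE => /andP[/eqP zu /eqP wu].
  apply/andP; split; apply/eqP.
    rewrite -[RHS]zu; apply: eq_bigr => i _.
    by rewrite tnth_mktuple inordK ?zle.
  rewrite -[RHS]wu; apply: eq_bigr => i _.
  by rewrite tnth_mktuple inordK ?wle.
rewrite !inE /= => /andP[/eqP tr /eqP ts].
pose u := [multinom (match split k with inl i => val (tnth t i)
                                   | inr i => val (tnth t' i) end) | k < m'.+1 + m'.+1].
have uz i : u (lshift _ i) = tnth t i.
  by rewrite mnmE (unsplitK (inl i)).
have uw i : u (rshift _ i) = tnth t' i.
  by rewrite mnmE (unsplitK (inr i)).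
have zu : zdeg u = r by rewrite -[RHS]tr; apply: eq_bigr => i _; rewrite uz.
have wu : wdeg u = s by rewrite -[RHS]ts; apply: eq_bigr => i _; rewrite uw.
have ub : (mdeg u < (r + s).+1)%N by rewrite mdeg_zw zu wu.
exists (BMultinom ub); first by rewrite inE /= zu wu !eqxx.
congr (_, _); apply/eq_from_tnth => i; rewrite tnth_mktuple /=.
  by rewrite uz inord_val.
by rewrite uw inord_val.
Qed.

(** The coordinates are indexed by an n-subset together with a monomial of bidegree (r, s), and the
    two are counted independently. *)
Lemma dim_bihomform m' (C : numClosedFieldType) r s n :
  \dim {:bihomform m'.+1 C r s n} = ('C(m'.+1, n) * ('C(m' + r, r) * 'C(m' + s, s)))%N.
Proof.
rewrite dimvf -[LHS]/#|{: bihom_idx m'.+1 r s n}| card_sig -card_bidegree_mnm.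
rewrite -[in X in 'C(X, n)](card_ord m'.+1) -card_draws -cardsX.
by apply: eq_card => -[I u]; rewrite !inE.
Qed.

(** * The closed formula satisfies the recursions *)

Section Arithmetic.
Context (m' : nat).
Local Notation m := m'.+1.
Implicit Types (r s n j : nat).

(* n / (r + n), with value 1 instead of 0 / 0. *)
Definition form_weight r n : rat := if r == 0%N then 1 else n%:R / (r + n)%:R.

(** One expression for all 0 <= n <= m: the first weight vanishes at n = 0 unless r = 0, the second
    at n = m unless s = 0, which gives the deltas at the endpoints. *)
Definition monogenic_dim r s n : rat :=
  ('C(m' + r, r) * 'C(m' + s, s) * 'C(m, n))%N%:R
    * form_weight r n * form_weight s (m - n) * ((r + s + m)%:R / m%:R).

Lemma form_weight_pos r n : (0 < n)%N -> form_weight r n = n%:R / (r%:R + n%:R).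
Proof.
rewrite /form_weight natrD; case: eqP => // -> n0; rewrite add0r divff //.
by rewrite pnatr_eq0 -lt0n.
Qed.

Lemma form_weightS r n : form_weight r.+1 n = n%:R / (r%:R + 1 + n%:R).
Proof. by rewrite /form_weight natrD natr1. Qed.

Lemma form_weight0 n : form_weight 0 n = 1. Proof. by []. Qed.

Lemma natr_binS r :
  'C(m' + r.+1, r.+1)%:R = 'C(m' + r, r)%:R * (m%:R + r%:R) / (r%:R + 1) :> rat.
Proof.
have : (r.+1 * 'C(m' + r.+1, r.+1) = (m + r) * 'C(m' + r, r))%N.
  by rewrite addnS -mul_bin_diag addSn.
move/(congr1 (fun k => k%:R : rat)); rewrite !natrM natrD -[r.+1%:R]natr1 => e.
have r0 : r%:R + 1 != 0 :> rat by rewrite natr1 pnatr_eq0.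
by apply: (mulfI r0); rewrite e; field.
Qed.

(** Writing m = n + j + 1 trades the truncated [m - n] for a natural variable that [field] can
    handle; the identities below do the same. *)
Lemma natr_bin_next n j : (n + j.+1)%N = m ->
  'C(m, n.+1)%:R = 'C(m, n)%:R * (j%:R + 1) / (n%:R + 1) :> rat.
Proof.
move=> mE; have /(congr1 (fun k => k%:R : rat)) := mul_bin_left m n.
rewrite !natrM -[in (m - n)%N]mE addKn -[n.+1%:R]natr1 -[j.+1%:R]natr1 => e.
have n0 : n%:R + 1 != 0 :> rat by rewrite natr1 pnatr_eq0.
by apply: (mulfI n0); rewrite e; field.
Qed.

Lemma natr_ge0 n : 0 <= n%:R :> rat. Proof. exact: ler0n. Qed.

(** The denominators left by [field] are positive: casts of naturals are abstracted to nonnegative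
    rationals and [lra] concludes. *)
Ltac field_nat := field; repeat (apply/andP; split);
  apply/lt0r_neq0; repeat (match goal with |- context [?n%:R] =>
    have := natr_ge0 n; move: (n%:R : rat) => ? end); lra.

Lemma monogenic_dim00 n : monogenic_dim 0 0 n = 'C(m, n)%:R.
Proof.
rewrite /monogenic_dim !form_weight0 !addn0 !bin0 !mul1n !mulr1.
by rewrite divff ?mulr1 // pnatr_eq0.
Qed.

(** First of five identities matching the recursion: the cases are r = 0, s = 0, and both positive,
    with the top form degree split off in the last two, since no forms lie above it. *)
Lemma monogenic_dim_sum0S s n : (n < m)%N ->
  monogenic_dim 0 s.+1 n.+1 + monogenic_dim 0 s n
    = ('C(m, n.+1) * 'C(m' + s.+1, s.+1))%N%:R.
Proof.
move=> nm; have [j mE] : exists j, (n + j.+1)%N = m by exists (m - n.+1)%N; lia.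
have jE : (m - n)%N = j.+1 by lia.
have jE' : (m - n.+1)%N = j by lia.
rewrite /monogenic_dim jE jE' !form_weight0 form_weightS form_weight_pos //.
rewrite !addn0 !bin0 !mul1n !add0n !natrM !natr_binS (natr_bin_next mE) !natrD.
have -> : m%:R = n%:R + j%:R + 1 :> rat by rewrite -mE natrD -natr1 addrA.
rewrite -[s.+1%:R]natr1 -[j.+1%:R]natr1.
field_nat.
Qed.

Lemma monogenic_dim_sumS0 r n : (n.+1 < m)%N ->
  monogenic_dim r.+1 0 n.+1 + monogenic_dim r 0 n.+2
    = ('C(m, n.+1) * 'C(m' + r.+1, r.+1))%N%:R.
Proof.
move=> nm; have [j mE] : exists j, (n.+1 + j.+1)%N = m by exists (m - n.+2)%N; lia.
have jE : (m - n.+1)%N = j.+1 by lia.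
have jE' : (m - n.+2)%N = j by lia.
rewrite /monogenic_dim jE jE' !form_weight0 form_weightS form_weight_pos //.
rewrite !addn0 !bin0 !muln1 !natrM !natr_binS (natr_bin_next mE) !natrD.
have -> : m%:R = n%:R + j%:R + 1 + 1 :> rat.
  by rewrite -mE natrD -!natr1; ring.
rewrite -[r.+1%:R]natr1 -[n.+2%:R]natr1 -[n.+1%:R]natr1.
field_nat.
Qed.

Lemma monogenic_dim_topS0 r :
  monogenic_dim r.+1 0 m = ('C(m, m) * 'C(m' + r.+1, r.+1))%N%:R.
Proof.
rewrite /monogenic_dim subnn form_weight0 form_weightS !addn0 bin0 binn.
rewrite !muln1 mul1n natrD -[r.+1%:R]natr1.
field_nat.
Qed.

(** Each pair on the left is the dimension of a closed harmonic space; the right side is that of the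
    harmonic space mapped by d. *)
Lemma monogenic_dim_sumSS r s n : (n.+1 < m)%N ->
  monogenic_dim r.+1 s.+1 n.+1 + monogenic_dim r.+1 s n
    + (monogenic_dim r s.+1 n.+2 + monogenic_dim r s n.+1)
    = 'C(m, n.+1)%:R * (('C(m' + r.+1, r.+1) * 'C(m' + s.+1, s.+1))%N%:R
                         - ('C(m' + r, r) * 'C(m' + s, s))%N%:R).
Proof.
move=> nm; have [j mE] : exists j, (n.+1 + j.+1)%N = m by exists (m - n.+2)%N; lia.
have mE' : (n + j.+2)%N = m by lia.
have jE : (m - n.+1)%N = j.+1 by lia.
have jE' : (m - n.+2)%N = j by lia.
have jE'' : (m - n)%N = j.+2 by lia.
rewrite /monogenic_dim jE jE' jE'' !form_weightS !form_weight_pos //.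
rewrite !natrM !natr_binS (natr_bin_next mE) (natr_bin_next mE') !natrD.
have -> : m%:R = n%:R + j%:R + 1 + 1 :> rat.
  by rewrite -mE natrD -!natr1; ring.
rewrite -[r.+1%:R]natr1 -[s.+1%:R]natr1 -[n.+2%:R]natr1 -[n.+1%:R]natr1.
rewrite -[j.+2%:R]natr1 -[j.+1%:R]natr1.
field_nat.
Qed.

Lemma monogenic_dim_topSS r s :
  monogenic_dim r.+1 s.+1 m + monogenic_dim r.+1 s m'
    = 'C(m, m)%:R * (('C(m' + r.+1, r.+1) * 'C(m' + s.+1, s.+1))%N%:R
                         - ('C(m' + r, r) * 'C(m' + s, s))%N%:R).
Proof.
have mE : (m' + 1)%N = m by rewrite addn1.
have jE : (m - m')%N = 1%N by lia.
rewrite /monogenic_dim subnn jE !form_weightS !form_weight_pos //.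
have bE : 'C(m, m')%:R = m%:R :> rat by rewrite binSn.
rewrite !natrM !natr_binS bE binn !natrD -[m%:R]natr1.
rewrite -[r.+1%:R]natr1 -[s.+1%:R]natr1.
field_nat.
Qed.

End Arithmetic.

(** * Solving the recursions *)

Section MonogenicDimension.
Context (m' : nat) (C : numClosedFieldType) (q : C).
Local Notation m := m'.+1.
Hypothesis q_torsionfree : forall k : nat, q ^+ k.+1 != 1.
Implicit Types (r s n : nat).

Lemma dim_harmonicE r s n : (\dim (harmonic m q r s n))%:R =
  'C(m, n)%:R * (('C(m' + r, r) * 'C(m' + s, s))%N%:R -
    (if (r, s) is (r'.+1, s'.+1)
     then ('C(m' + r', r') * 'C(m' + s', s'))%N%:R else 0)) :> rat.
Proof.
case: r s => [|r] [|s]; rewrite ?dim_harmonic_zdeg0 ?dim_harmonic_wdeg0 ?dim_bihomform;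
  try by rewrite natrM subr0.
apply/eqP; rewrite mulrBr eq_sym subr_eq -!natrM -natrD eqr_nat -!(dim_bihomform _ C).
by rewrite -(dim_harmonicS _ q_torsionfree).
Qed.

(** Induction on r, starting from r = 0 where every element is closed and harmonic. Form degree
    [n.+1] ensures the positivity condition of [dim_closed_harmonicS]. *)
Lemma dim_closed_harmonicE r s n : (n < m)%N ->
  (\dim (closed_harmonic m q r s n.+1))%:R =
    monogenic_dim m' r s n.+1 + (if s is s'.+1 then monogenic_dim m' r s' n else 0).
Proof.
elim: r n => [|r IHr] n nm.
  rewrite dim_closed_harmonic_zdeg0 dim_bihomform; case: s => [|s].
    by rewrite addr0 monogenic_dim00 // !addn0 !bin0 !muln1.
  by rewrite monogenic_dim_sum0S // addn0 bin0 mul1n.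
have := @dim_closed_harmonicS m C q isT q_torsionfree r s n.+1.
rewrite addnS => /(_ isT)/(congr1 (fun k => k%:R : rat)).
rewrite natrD dim_harmonicE.
have [n1m|mn] := ltnP n.+1 m.
  rewrite IHr // {IHr}; case: s => [|s] /eqP; rewrite eq_sym -subr_eq => /eqP <-.
    by rewrite subr0 addn0 bin0 muln1 -natrM -monogenic_dim_sumS0 // !addr0 addrK.
  by rewrite -monogenic_dim_sumSS // addrK.
(* At the top form degree the image of d is zero, as there are no (m + 1)-forms. *)
have -> : \dim (closed_harmonic m q r s n.+2) = 0%N.
  by apply/eqP; rewrite -leqn0 (leq_trans (dimvS (subvf _))) // dim_bihomform bin_small.
have -> : n = m' by apply/eqP; rewrite eqn_leq -ltnS nm.
rewrite addr0 => -> {IHr}; case: s => [|s].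
  by rewrite subr0 addr0 -natrM addn0 bin0 muln1 monogenic_dim_topS0.
by rewrite monogenic_dim_topSS.
Qed.

Lemma dim_monogenic_form0 r s :
  \dim (monogenic m q r s 0) = ((r == 0) * 'C(m' + s, s))%N.
Proof.
case: r => [|r]; last by rewrite dim_monogenic_form0S.
by rewrite dim_monogenic_form0_zdeg0 dim_bihomform addn0 !bin0 !mul1n.
Qed.

(** Induction on s, with 0-forms treated directly because the recursion lowers the form degree. In
    the step the term known by induction appears on both sides and cancels. *)
Lemma dim_monogenicE r s n : (n <= m)%N ->
  (\dim (monogenic m q r s n))%:R = monogenic_dim m' r s n.
Proof.
elim: s n => [|s IHs] [|n] nm.
- rewrite dim_monogenic_form0 /monogenic_dim.
  case: r => [|r] /=; last by rewrite form_weightS !mul0r mulr0 !mul0r.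
  by rewrite !form_weight0 !addn0 !bin0 !mulr1 add0n divff ?mulr1 ?pnatr_eq0.
- by rewrite dim_monogenic_wdeg0 dim_closed_harmonicE // addr0.
- rewrite dim_monogenic_form0 /monogenic_dim.
  case: r {IHs} => [|r] /=; last by rewrite form_weightS !mul0r mulr0 !mul0r.
  rewrite form_weight0 /form_weight /= subn0 addn0 !bin0 !mul1n muln1 mulr1 add0n.
  rewrite -mulrA -[m%:R / _]invf_div mulVf ?mulr1 //.
  by rewrite mulf_neq0 ?invr_eq0 ?pnatr_eq0.
have nsm : (n < s + m)%N by rewrite (leq_trans nm) ?leq_addl.
have /(congr1 (fun k => k%:R : rat)) := dim_monogenicS q_torsionfree r nsm.
rewrite natrD dim_closed_harmonicE // IHs ?(ltnW nm) //.
exact: addIr.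
Qed.

Lemma dim_monogenic_top r s :
  \dim (monogenic m q r s m) = ((s == 0) * 'C(m' + r, r))%N.
Proof.
apply: (mulrIn (oner_neq0 rat)); rewrite dim_monogenicE //.
case: s => [|s] /=.
  case: r => [|r]; first by rewrite monogenic_dim00 // binn addn0 bin0.
  by rewrite monogenic_dim_topS0 binn.
by rewrite /monogenic_dim subnn form_weightS mul0r mulr0 mul0r.
Qed.

End MonogenicDimension.

(** * Factorial form of the dimensions and the theorem *)

Lemma natr_bin_fact a b : 'C(a + b, b)%:R = (a + b)`!%:R / (a`! * b`!)%:R :> rat.
Proof.
rewrite -(bin_fact (leq_addl a b)) addnK [(b`! * _)%N]mulnC natrM mulfK //.
by rewrite pnatr_eq0 -lt0n muln_gt0 !fact_gt0.
Qed.

(** Strictly between the endpoints both weights are genuine quotients, and their numerators turn the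
    factorials of n + 1 and j + 1 into those of n and j. *)
Lemma monogenic_dim_factE m' r s n j : (n.+1 + j.+1)%N = m'.+1 ->
  monogenic_dim m' r s n.+1 =
    ((r + m')`! * (s + m')`! * (r + s + m'.+1))%N%:R
    / (r`! * s`! * m'`! * n`! * j`! * (r + n.+1) * (s + j.+1))%N%:R.
Proof.
move=> mE; rewrite /monogenic_dim -mE addKn mE !form_weight_pos //.
have -> : 'C(m'.+1, n.+1) = 'C(j.+1 + n.+1, n.+1) by rewrite addnC mE.
rewrite !natrM !natr_bin_fact [(j.+1 + _)%N]addnC mE ![(m' + _)%N]addnC.
rewrite !factS !natrM !natrD.
have fact0 k : k`!%:R != 0 :> rat by rewrite pnatr_eq0 -lt0n fact_gt0.
have pos0 (a b : nat) : a%:R + b.+1%:R != 0 :> rat by rewrite -natrD addnS pnatr_eq0.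
have S0 (a : nat) : a.+1%:R != 0 :> rat by rewrite pnatr_eq0.
by field; rewrite !nat1r !pos0 !fact0 !S0.
Qed.

Theorem corollary5p6 (R : realType) (m r s : nat) (hm : (1 <= m)%N) :
  (forall (n : nat) (q q' : R), (n <= m)%N -> 0 < q < 1 -> 0 < q' < 1 ->
     dim_monogenic m q r s n = dim_monogenic m q' r s n) /\
  (forall q : R, 0 < q < 1 ->
     (forall n : nat, (1 <= n <= m - 1)%N ->
        (dim_monogenic m q r s n)%:R =
          (((r + m - 1)`! * (s + m - 1)`! * (r + s + m))%N%:R
           / (r`! * s`! * (m - 1)`! * (n - 1)`! * (m - n - 1)`!
              * (r + n) * (s + m - n))%N%:R) :> rat) /\
     dim_monogenic m q r s 0 = ((r == 0) * 'C(s + m - 1, m - 1))%N /\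
     dim_monogenic m q r s m = ((s == 0) * 'C(r + m - 1, m - 1))%N).
Proof.
case: m hm => [//|m' _].
(* Positive powers of a real q in (0, 1) stay below 1, and the embedding into [R[i]] is
   injective. *)
have torsionfree (q : R) : 0 < q < 1 -> forall k : nat, (q%:C%C : R[i]) ^+ k.+1 != 1.
  case/andP => q0 q1 k; rewrite -rmorphXn -[1](rmorph1 (real_complex R)) /=.
  by rewrite (inj_eq (@complexI R)) lt_eqF // exprn_ilt1 // ltW.
have binE k : 'C(k + m'.+1 - 1, m'.+1 - 1) = 'C(m' + k, k).
  by rewrite addnS !subn1 /= addnC -[RHS]bin_sub ?leq_addl // addnK.
split=> [n q q' nm /torsionfree hq /torsionfree hq'|q /torsionfree hq].
  (* After the injective cast to the rationals both dimensions equal [monogenic_dim], in which q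
     does not occur. *)
  apply: (mulrIn (oner_neq0 rat)).
  exact: etrans (dim_monogenicE hq r s nm) (esym (dim_monogenicE hq' r s nm)).
rewrite /dim_monogenic !binE (dim_monogenic_form0 m' hq) (dim_monogenic_top m' hq).
split=> // -[|n] // nm.
have [j mE] : exists j, (n.+1 + j.+1)%N = m'.+1 by exists (m'.+1 - n.+2)%N; lia.
rewrite dim_monogenicE ?(monogenic_dim_factE r s mE) //; last by lia.
rewrite !addnS !subn1 /= -mE.
by congr (_ / (_ * _`! * _`! * _ * _)%:R); lia.
Qed.
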